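(* Let $n\in\mathbb{N}$, let $\rho$ be a $C^1$, positive function on $(0,\infty)$ such that $s_1^\rho$ is strictly increasing, and let $\sigma$ be the inverse function of $s_1^\rho$. For any $x\in\mathbb{R}^n\setminus\{0\}$, the sequence $\{f^\rho_{n,N}(x)\}_{N}$, where $f^\rho_{n,N}$ is the density of $(P^\rho_{n,N})_\sharp v_N$ with respect to the Lebesgue measure on $\mathbb{R}^n$, converges as $N\to\infty$ to \[ f^\rho_n(x):=\begin{cases}\displaystyle (2\pi)^{-n/2}\exp\left(-\frac{\sigma(|x|)^2}{2}\right)\left\{\frac{\sigma(|x|)}{|x|}\right\}^{n-1}\sigma'(|x|) & \text{if } x\in s_n^\rho(\mathbb{R}^n\setminus\{0\}),\\ 0 & \text{otherwise.}\end{cases} \] The function $f_n^\rho$ has unit mass on $\mathbb{R}^n$ with respect to the Lebesgue measure, and hence $\{(P^\rho_{n,N})_\sharp v_N\}_{N}$ converges weakly, as $N\to\infty$, to the absolutely continuous probability measure $\nu_n^\rho$ on $\mathbb{R}^n$ such that $d\nu_n^\rho/dx=f_n^\rho$.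
   Context: $|\cdot|$ is the Euclidean norm. For a function $\rho$ on $(0,\infty)$ and $n\in\mathbb{N}$, the map $s_n^\rho:\mathbb{R}^n\to\mathbb{R}^n$ is $s_n^\rho(x)=\rho(|x|)x$ for $x\ne0$ and $s_n^\rho(0)=0$; in particular $s_1^\rho:\mathbb{R}\to\mathbb{R}$. $S_N\subset\mathbb{R}^N$ is the $(N-1)$-dimensional Euclidean sphere of radius $N^{1/2}$ centered at $0$, and $v_N$ is the uniform probability measure on $S_N$. For $N>n$, $P_{n,N}:S_N\to\mathbb{R}^n$ is the restriction to $S_N$ of the orthogonal projection of $\mathbb{R}^N$ onto the first $n$ coordinates, and $P^\rho_{n,N}:=s_n^\rho\circ P_{n,N}$. The push-forward is $(P^\rho_{n,N})_\sharp v_N[A]=v_N[(P^\rho_{n,N})^{-1}(A)]$ for Borel $A\subset\mathbb{R}^n$. Pointwise values of the density $f^\rho_{n,N}$ are understood as follows: for $x\in P^\rho_{n,N}(S_N)\setminus\{0\}$, $f^\rho_{n,N}(x)=\lim_{\varepsilon\downarrow0}\frac{1}{\varepsilon^nV_n}v_N[(P^\rho_{n,N})^{-1}(B_\varepsilon(x))]$, where $B_\varepsilon(x)$ is the open ball with center $x$ and radius $\varepsilon$ and $V_n$ is the volume of the unit ball in $\mathbb{R}^n$; and $f^\rho_{n,N}(x)=0$ for $x\notin P^\rho_{n,N}(S_N)$.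
   Formalization: Density, unit mass and weak convergence are stated when {t>0 : (s_1^ρ)'(t)=0} is Lebesgue-null; otherwise the push-forwards have a singular part and f_n^ρ has mass < 1. Where (s_1^ρ)' vanishes, σ' and the densities take the value +∞. *)

(* Defs.v *)
From HB Require Import structures.
From mathcomp Require Import all_boot all_order all_algebra.
From mathcomp Require Import all_classical all_reals all_analysis.
From mathcomp Require Import lra measurable_realfun.

Set Implicit Arguments.
Unset Strict Implicit.
Unset Printing Implicit Defensive.

Import Order.TTheory GRing.Theory Num.Theory.
Import numFieldNormedType.Exports.

Local Open Scope classical_set_scope.
Local Open Scope ring_scope.

(* Borel sigma-algebra of the (entrywise) topology of matrices; on 'rV[R]_n
   this is the Euclidean topology. *)
HB.instance Definition _ (R : realType) m n :=
  @isMeasurable.Build (sigma_display (@open 'M[R]_(m, n))) 'M[R]_(m, n)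
    <<s @open 'M[R]_(m, n) >> (@sigma_algebra0 _ setT _)
    (@sigma_algebraC _ _) (@sigma_algebra_bigcup _ setT _).

(* The library norm `|x| on 'rV[R]_n is the sup norm. *)
Definition enorm (R : realType) n (x : 'rV[R]_n) : R :=
  Num.sqrt (\sum_(i < n) x 0 i ^+ 2).

Definition eball (R : realType) n (x : 'rV[R]_n) (r : R) : set 'rV[R]_n :=
  [set y | enorm (y - x) < r].

Definition row_cons (R : realType) n (p : measurableTypeR R * 'rV[R]_n) :
  'rV[R]_(1 + n) := row_mx (p.1)%:M p.2.

(* Lebesgue measure on R^n as the iterated product of the Lebesgue measure of
   the line, along R^(1 + n) = R * R^n. *)
Fixpoint lebesgue_rV (R : realType) n : set 'rV[R]_n -> \bar R :=
  match n with
  | 0 => dirac (0 : 'rV[R]_0)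
  | n'.+1 => pushforward (@lebesgue_measure R \x @lebesgue_rV R n')%E
               (@row_cons R n')
  end.

Section lebesgue_rV_measure.
Context {R : realType}.

Let rbox n (q : 'rV[rat]_n * 'rV[rat]_n) : set 'rV[R]_n :=
  [set x | forall i, ratr (q.1 0 i) < x 0 i < ratr (q.2 0 i)].

Let open_bigcup_rbox n (U : set 'rV[R]_n) : open U ->
  U = \bigcup_(q in [set q | rbox q `<=` U]) rbox q.
Proof.
move=> oU; apply/seteqP; split; last by move=> x [q qU /qU].
move=> x Ux; have : nbhs x U by exact: open_nbhs_nbhs.
case => P Px PU.
have /choice[q qP] : forall i, exists q : rat * rat,
    ratr q.1 < x 0 i < ratr q.2 /\
    (forall y : R, ratr q.1 < y < ratr q.2 -> P 0 i y).
  move=> i; have [e /= e0 eP] := Px 0 i.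
  have [a] := @rat_in_itvoo R (x 0 i - e) (x 0 i)
    ltac:(by rewrite ltrBlDr ltrDl).
  have [b] := @rat_in_itvoo R (x 0 i) (x 0 i + e) ltac:(by rewrite ltrDl).
  rewrite !in_itv/= => /andP[b1 b2] /andP[a1 a2].
  exists (a, b); split => /=; first by rewrite a2 b1.
  move=> y /andP[ay yb]; apply: eP => /=; rewrite /ball_/= distrC ltr_distlC.
  by apply/andP; split; lra.
exists (\row_i (q i).1, \row_i (q i).2) => /=; last first.
  by move=> i /=; rewrite !mxE; have [] := qP i.
move=> y yq; apply: PU => i j; rewrite ord1; have [_] := qP j; apply.
by have := yq j; rewrite !mxE.
Qed.

Lemma measurable_coord n i :
  measurable_fun setT (fun x : 'rV[R]_n => x 0 i : measurableTypeR R).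
Proof.
apply: (measurability _ (RGenOInfty.measurableE R)) => _ [_ [a ->] <-].
rewrite setTI; apply: sub_sigma_algebra.
by apply: open_comp => // x _; exact: coord_continuous.
Qed.

Lemma measurable_rVP d (T : measurableType d) n (f : T -> 'rV[R]_n) :
  measurable_fun setT f <->
  forall i, measurable_fun setT (fun x => f x 0 i : measurableTypeR R).
Proof.
split=> mf; first by move=> i; exact: (measurableT_comp (measurable_coord i)).
apply: (measurability (@open 'rV[R]_n)) => //.
move=> _ [U oU <-]; rewrite setTI (open_bigcup_rbox oU) preimage_bigcup.
rewrite bigcup_mkcond; apply: countable_bigcupT_measurable.
  exact: countableP.
move=> q; case: ifP => // _.
have -> : f @^-1` rbox q = \bigcap_(i in [set: 'I_n])
    ((fun x => f x 0 i) @^-1` `]ratr (q.1 0 i), ratr (q.2 0 i)[).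
  apply/seteqP; split => [x /= xq i _|x xq i] /=.
    by rewrite in_itv/=; exact: xq.
  by have := xq i Logic.I; rewrite /= in_itv.
apply: fin_bigcap_measurable => // i _.
by rewrite -[X in measurable X]setTI; apply: mf.
Qed.

Lemma measurable_row_cons n : measurable_fun setT (@row_cons R n).
Proof.
apply/measurable_rVP => i.
case: (@split_ordP 1 n i) => j ->; rewrite /row_cons.
  under eq_fun do rewrite row_mxEl mxE ord1 mulr1n.
  exact: measurable_fst.
under eq_fun do rewrite row_mxEr.
exact: (measurableT_comp (measurable_coord _)).
Qed.

Let row_uncons n (x : 'rV[R]_(1 + n)) : measurableTypeR R * 'rV[R]_n :=
  (x 0 0, rsubmx x).

Let measurable_row_uncons n : measurable_fun setT
  (@row_uncons n).
Proof.
apply/measurable_fun_pairP; split; first exact: measurable_coord.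
apply/measurable_rVP => i; rewrite /comp/=.
under eq_fun do rewrite mxE.
exact: measurable_coord.
Qed.

Let lebesgue_rV_sigma_finite_measure n :
  exists mu : {sigma_finite_measure set 'rV[R]_n -> \bar R},
    @lebesgue_rV R n = mu.
Proof.
elim: n => [|n [mu IH]].
  by exists (dirac (0 : 'rV[R]_0)).
rewrite /= IH; set leb2 := (_ \x _)%E.
have [F FT Foo] : sigma_finite setT leb2.
  have /sigma_finiteP[F [TF ndF Foo]] := sigma_finiteT (@lebesgue_measure R).
  have /sigma_finiteP[G [TG ndG Goo]] := sigma_finiteT mu.
  exists (fun k => F k `*` G k).
    apply/seteqP; split=> // -[x y] _.
    have [i _ Fx] : (\bigcup_i F i) x by rewrite -TF.
    have [j _ Gy] : (\bigcup_i G i) y by rewrite -TG.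
    exists (maxn i j) => //; split => /=.
      by move: x Fx; exact/subsetPset/ndF/leq_maxl.
    by move: y Gy; exact/subsetPset/ndG/leq_maxr.
  move=> k; have [? ?] := Foo k; have [? ?] := Goo k.
  split; first exact: measurableX.
  by rewrite /leb2 product_measure1E// lte_mul_pinfty// ge0_fin_numE.
have sf : sigma_finite setT (pushforward leb2 (@row_cons R n)).
  exists (fun k => @row_uncons n @^-1` F k).
    by rewrite -preimage_bigcup -FT preimage_setT.
  move=> k; have [mF Fk] := Foo k; split.
    by rewrite -[X in measurable X]setTI; exact: measurable_row_uncons.
  suff -> : pushforward leb2 (@row_cons R n)
      (@row_uncons n @^-1` F k) = leb2 (F k) by [].
  congr (leb2 _); apply/seteqP; split=> -[t y] /=;
    by rewrite /row_uncons row_mxKr -(lshift0 n 0) row_mxEl mxE eqxx mulr1n.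
have m0 : pushforward leb2 (@row_cons R n) set0 = 0%E.
  by rewrite measure0//; exact: measurable_row_cons.
have mge0 A : (0 <= pushforward leb2 (@row_cons R n) A)%E.
  by rewrite measure_ge0//; exact: measurable_row_cons.
have madd : semi_sigma_additive (pushforward leb2 (@row_cons R n)).
  by apply: measure_semi_sigma_additive; exact: measurable_row_cons.
pose P (A : set 'rV[R]_(1 + n)) := leb2 (@row_cons R n @^-1` A).
pose M := isMeasure.Build _ _ _ P m0 mge0 madd.
pose mM : {measure set 'rV[R]_(1 + n) -> \bar R} := HB.pack P M.
pose S := Measure_isSigmaFinite.Build _ _ _ mM sf.
pose sM : {sigma_finite_measure set 'rV[R]_(1 + n) -> \bar R} :=
  HB.pack P M S.
by exists sM.
Qed.

Let lebesgue_rV0 n : @lebesgue_rV R n set0 = 0%E.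
Proof. by have [mu ->] := lebesgue_rV_sigma_finite_measure n. Qed.

Let lebesgue_rV_ge0 n A : (0 <= @lebesgue_rV R n A)%E.
Proof. by have [mu ->] := lebesgue_rV_sigma_finite_measure n. Qed.

Let lebesgue_rV_semi_sigma_additive n : semi_sigma_additive (@lebesgue_rV R n).
Proof.
have [mu ->] := lebesgue_rV_sigma_finite_measure n.
exact: measure_semi_sigma_additive.
Qed.

HB.instance Definition _ n := isMeasure.Build _ _ _ (@lebesgue_rV R n)
  (lebesgue_rV0 n) (@lebesgue_rV_ge0 n) (@lebesgue_rV_semi_sigma_additive n).

Let lebesgue_rV_sigma_finite n : sigma_finite setT (@lebesgue_rV R n).
Proof.
have [mu ->] := lebesgue_rV_sigma_finite_measure n; exact: sigma_finiteT.
Qed.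

HB.instance Definition _ n := Measure_isSigmaFinite.Build _ _ _
  (@lebesgue_rV R n) (@lebesgue_rV_sigma_finite n).

End lebesgue_rV_measure.

Definition sphere (R : realType) N : set 'rV[R]_N :=
  [set x | enorm x = Num.sqrt N%:R].

(* Uniform probability measure on [sphere N], as a Borel measure on R^N: the
   normalized surface measure, whose value at A is the share of the unit ball
   lying on the rays through A. *)
Definition sphere_unif (R : realType) N (A : set 'rV[R]_N) : \bar R :=
  (lebesgue_rV
     (eball 0 1 `&` [set x | A ((Num.sqrt N%:R / enorm x) *: x)%R])
   * ((fine (lebesgue_rV (eball (0 : 'rV[R]_N) 1)))^-1)%:E)%E.

Definition radial_map (R : realType) (rho : R -> R) n (x : 'rV[R]_n) :
  'rV[R]_n := if x == 0 then 0 else rho (enorm x) *: x.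

(* [radial_map] in dimension 1, with R^1 identified with R *)
Definition radial_map1 (R : realType) (rho : R -> R) (t : R) : R :=
  if t == 0 then 0 else rho `|t| * t.

(* On row vectors, multiplication by [pid_mx n] keeps the first n coordinates
   when n <= N; the value for N < n is irrelevant. *)
Definition radial_proj (R : realType) (rho : R -> R) n N (x : 'rV[R]_N) :
  'rV[R]_n := radial_map rho (x *m pid_mx n).

Definition proj_measure (R : realType) (rho : R -> R) n N :
  set 'rV[R]_n -> \bar R :=
  pushforward (@sphere_unif R N) (@radial_proj R rho n N).

Definition proj_ball_ratio (R : realType) (rho : R -> R) n N (x : 'rV[R]_n)
    (e : R) : \bar R :=
  (proj_measure rho N (eball x e)
   * ((e ^+ n * fine (lebesgue_rV (eball (0 : 'rV[R]_n) 1)))^-1)%:E)%E.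

(* Extended-real valued: the limit is +oo at the images of points where the
   derivative of [radial_map1 rho] vanishes. *)
Definition proj_density (R : realType) (rho : R -> R) n N (x : 'rV[R]_n) :
  \bar R :=
  if x \in (@radial_proj R rho n N @` @sphere R N) `\ 0
  then lim (proj_ball_ratio rho N x e @[e --> 0^'+])
  else 0%E.

(* Derivative as a limit in \bar R: the derivative of the inverse of a
   C^1 increasing function is +oo at critical values, where the real-valued
   [derive1] would return a default value. *)
Definition ederive1 (R : realType) (f : R -> R) (r : R) : \bar R :=
  lim ((h^-1 * (f (h + r) - f r))%:E @[h --> 0^']).

Definition limit_density (R : realType) (rho sigma : R -> R) n
    (x : 'rV[R]_n) : \bar R :=
  if x \in @radial_map R rho n @` [set y | y != 0]
  then (((2 * pi) `^ (- (n%:R / 2)) * expR (- (sigma (enorm x) ^+ 2 / 2))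
         * (sigma (enorm x) / enorm x) ^+ n.-1)%:E
        * ederive1 sigma (enorm x))%E
  else 0%E.

(* f is a density of mu with respect to the Lebesgue measure; f itself is only
   required to be measurable up to a null set. *)
Definition is_density (R : realType) n (mu : set 'rV[R]_n -> \bar R)
    (f : 'rV[R]_n -> \bar R) :=
  exists g : 'rV[R]_n -> \bar R,
    [/\ measurable_fun setT g, forall x, (0 <= g x)%E,
        f = g %[ae @lebesgue_rV R n] &
        forall A, measurable A ->
          mu A = (\int[@lebesgue_rV R n]_(x in A) g x)%E].

Definition weakly_converges (R : realType) n
    (mu : nat -> set 'rV[R]_n -> \bar R) (nu : set 'rV[R]_n -> \bar R) :=
  forall phi : 'rV[R]_n -> R, continuous phi ->
    (exists M : R, forall x, `|phi x| <= M) ->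
    (\int[mu N]_x (phi x)%:E)%E @[N --> \oo]
      --> (\int[nu]_x (phi x)%:E)%E.

(* Main.v *)
From HB Require Import structures.
Require Import Defs.
From mathcomp Require Import all_boot all_order all_algebra.
From mathcomp Require Import all_classical all_reals all_analysis.
From mathcomp Require Import measurable_realfun ring lra.

Import Order.TTheory GRing.Theory Num.Theory.
Import numFieldNormedType.Exports.
Import HBNNSimple.

Local Open Scope classical_set_scope.
Local Open Scope ring_scope.

(** The value of the uniform measure at A is the share of the unit ball of
    R^N whose radial projection to the sphere falls in A. Split a point of
    the ball as (u, w), with u in R^n and w in R^(N - n). Its projection to
    the sphere of radius c has first coordinates c u / sqrt (|u|^2 + |w|^2).
    For fixed t = |w| this is a radial map of u, with profile
    r |-> c r / sqrt (r^2 + t^2), so a change of variables along a radial map,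
    followed by an integration over w, gives the law of the first n
    coordinates ([ball_cone_marginal]): its density at z is a constant times
    (1 - |z|^2 / N)^((N - n - 2) / 2) for |z| < sqrt N and 0 beyond
    ([proj_measure_push_mass]). As N grows this tends to exp (- |z|^2 / 2),
    with the Gaussian exp (- |z|^2 / 4) as a majorant, so that dominated
    convergence gives the limit of the integrals; since the total mass is
    always 1, it also identifies the limit of the constants
    ([cap_profile_integral_cvg], [marginal_scale_cvg]).

    The map x |-> rho(|x|) x is again radial, with profile s(r) = rho(r) r.
    Its Jacobian at radius r is J(r) = s'(r) (s(r) / r)^(n - 1)
    ([profile_change_of_variables], proved in polar coordinates), so a radial
    density f is pushed to f(r) / J(r) at radius s(r). The pointwise statement
    about shrinking balls only uses that f and J are continuous at r and that
    f(r) > 0: near r, f is squeezed between two multiples of J, and the integral of J over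
    the preimage of a ball is the volume of that ball. The same argument gives
    the value +oo where s' vanishes, in agreement with the extended derivative
    of the inverse profile ([ball_ratio_cvg], [ederive1_profile_inverse]).
    Together with the convergence of the marginal densities this proves the
    pointwise convergence.

    If the critical points of s form a null set, the change of variables can
    be divided by J almost everywhere, and the images have the densities
    f(r) / J(r) ([integral_push_density]). Applied to the marginal densities
    this shows that the push-forwards are absolutely continuous, and applied
    to the standard Gaussian that the limit density has unit mass. Weak
    convergence follows by transporting a test function back along the radial
    map and using the convergence of integrals above. *)

(** * Measures with a density, and images of measures *)

Section density.
Context d (T : measurableType d) (R : realType).
Implicit Types mu nu : {measure set T -> \bar R}.
Local Open Scope ereal_scope.

Lemma density_measure_exists mu (g : T -> \bar R) :
  measurable_fun setT g -> (forall x, 0 <= g x) ->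
  exists nu : {measure set T -> \bar R},
    nu = (fun A => \int[mu]_(x in A) g x) :> (set T -> \bar R).
Proof.
move=> mg g0; pose P (A : set T) := \int[mu]_(x in A) g x.
have P0 : P set0 = 0 by exact: integral_set0.
have Pge0 A : 0 <= P A by exact: integral_ge0.
have Padd : semi_sigma_additive P by exact: semi_sigma_additive_nng_induced.
pose M := isMeasure.Build _ _ _ P P0 Pge0 Padd.
by exists (HB.pack P M : {measure set T -> \bar R}).
Qed.

(** Holds for indicators by hypothesis, hence for simple functions, and passes
    to increasing limits of simple functions on both sides. *)
Lemma integral_density mu nu (g : T -> R) (f : T -> \bar R) :
  measurable_fun setT g -> (forall x, (0 <= g x)%R) ->
  measurable_fun setT f -> (forall x, 0 <= f x) ->
  (forall A, measurable A -> nu A = \int[mu]_(x in A) (g x)%:E) ->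
  \int[nu]_x f x = \int[mu]_x (f x * (g x)%:E).
Proof.
move=> mg g0 mf f0 nuE.
have mEg : measurable_fun setT (EFin \o g) by exact/measurable_EFinP.
pose h := nnsfun_approx measurableT mf.
have fE x : f x = lim ((EFin \o h n) x @[n --> \oo]).
  by apply/esym/cvg_lim => //; exact: cvg_nnsfun_approx.
have -> : \int[nu]_x f x = limn (fun n => \int[nu]_x (EFin \o h n) x).
  under eq_integral do rewrite fE.
  apply: monotone_convergence => //.
  - by move=> n; exact/measurable_EFinP.
  - by move=> n x _; rewrite lee_fin.
  - by move=> x _ a b ab; rewrite lee_fin; exact/lefP/nd_nnsfun_approx.
have -> : \int[mu]_x (f x * (g x)%:E) =
    limn (fun n => \int[mu]_x ((EFin \o h n) x * (g x)%:E)).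
  have fg x : f x * (g x)%:E =
      lim (((EFin \o h n) x * (g x)%:E) @[n --> \oo]).
    apply/esym/cvg_lim; first exact: ereal_hausdorff.
    apply: cvgeZr => //.
    exact: cvg_nnsfun_approx.
  under eq_integral do rewrite fg.
  apply: monotone_convergence => //.
  - by move=> n; apply: emeasurable_funM => //; exact/measurable_EFinP.
  - by move=> n x _; rewrite mule_ge0// lee_fin.
  - move=> x _ a b ab; rewrite lee_wpmul2r ?lee_fin//.
    exact/lefP/nd_nnsfun_approx.
(* It remains to treat a simple function, as a sum over its finite range. *)
suff suf n : \int[nu]_x (EFin \o h n) x =
    \int[mu]_x ((EFin \o h n) x * (g x)%:E) by under eq_fun do rewrite suf.
transitivity (\int[nu]_x
   (\sum_(y \in range (h n)) (y * \1_(h n @^-1` [set y]) x)%:E)).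
  by apply: eq_integral => t tE; rewrite /= fimfunE -fsumEFin.
have mh r : measurable (h n @^-1` [set r]) by [].
rewrite ge0_integral_fsum//; last 2 first.
- by move=> r; apply/measurable_EFinP; apply: measurable_funM.
- by move=> m y Ey; exact: nnfun_muleindic_ge0.
transitivity (\int[mu]_x (\sum_(y \in range (h n))
    (y * \1_(h n @^-1` [set y]) x)%:E * (g x)%:E)); last first.
  apply: eq_integral => x _; rewrite /= [in RHS]fimfunE -fsumEFin//.
  by rewrite ge0_mule_fsuml// => y; exact: nnfun_muleindic_ge0.
rewrite ge0_integral_fsum//; last 2 first.
- move=> y; apply: emeasurable_funM => //; apply/measurable_EFinP.
  by apply: measurable_funM.
- by move=> m y Ey; apply: mule_ge0; [exact: nnfun_muleindic_ge0|
                                      rewrite lee_fin].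
apply: eq_fsbigr => r /[!inE] -[t _ <-].
under eq_integral do rewrite EFinM.
under [RHS]eq_integral do rewrite EFinM -muleA.
rewrite ge0_integralZl//; last 2 first.
- exact/measurable_EFinP.
- by rewrite lee_fin.
rewrite integral_indic// setIT nuE// ge0_integralZl//; last 3 first.
- by apply: emeasurable_funM => //; exact/measurable_EFinP.
- by move=> x _; rewrite mule_ge0 ?lee_fin.
- by rewrite lee_fin.
congr (_ * _); rewrite integral_mkcond; apply: eq_integral => x _.
by rewrite patchE indicE; case: ifPn; rewrite ?mul1e ?mul0e.
Qed.

End density.

Section real_line.
Context {R : realType}.
Notation mu := (@lebesgue_measure R).

(** F is nondecreasing and continuous, hence generates a Lebesgue-Stieltjes
    measure. Both sides agree with it on half-open intervals: [m] by
    hypothesis, the integral of f by the fundamental theorem of calculus. This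
    is how equalities of measures on the line are reduced below to the mass of
    intervals. *)
Lemma measure_by_antiderivative (F f : R -> R)
    (m : {measure set (measurableTypeR R) -> \bar R}) :
  (forall x, is_derive x (1 : R) F (f x)) -> continuous f ->
  (forall x, 0 <= f x) ->
  (forall a b : R, a < b -> m `]a, b]%classic = (F b - F a)%:E) ->
  forall A, measurable A -> m A = (\int[mu]_(x in A) (f x)%:E)%E.
Proof.
move=> dF cf f0 mab.
have cF : continuous F.
  move=> x; apply: differentiable_continuous.
  by apply/derivable1_diffP; exact: (@ex_derive _ _ _ _ _ _ _ (dF x)).
have ndF : {homo F : x y / x <= y}.
  move=> x y xy; rewrite -subr_ge0 -lee_fin.
  move: xy; rewrite le_eqVlt => /predU1P[->|xy]; first by rewrite subrr.
  by rewrite -mab.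
pose C := isCumulative.Build R _ R F ndF (right_continuousW cF).
pose cumF : cumulative R R := HB.pack F C.
have mf : measurable_fun setT (fun x : measurableTypeR R => (f x)%:E).
  by apply/measurable_EFinP; exact: continuous_measurable_fun.
have [nu nuE] := @density_measure_exists _ _ _ mu _ mf
  ltac:(by move=> x; rewrite lee_fin).
have key (m' : {measure set (measurableTypeR R) -> \bar R}) :
  (forall a b : R, a < b -> m' `]a, b]%classic = (F b - F a)%:E) ->
  forall A, measurable A -> lebesgue_stieltjes_measure cumF A = m' A.
  move=> m'ab; apply: lebesgue_stieltjes_measure_unique => X.
  move=> /ocitvP[->|[[a b]/= ab ->]]; first by rewrite !measure0.
  rewrite m'ab// /lebesgue_stieltjes_measure.
  rewrite /measure_extension measurable_mu_extE/=; last exact: is_ocitv.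
  by rewrite wlength_itv_bnd// ltW.
suff nuab a b : a < b -> nu `]a, b]%classic = (F b - F a)%:E.
  by move=> A mA; rewrite -key// (key nu)// nuE.
move=> ab; rewrite nuE integral_itv_obnd_cbnd; last exact: measurable_funTS.
rewrite (@continuous_FTC2 _ f F)//.
- exact: continuous_subspaceT.
- split; first by move=> x _; case: (dF x).
    exact: cvg_at_right_filter (cF a).
  exact: cvg_at_left_filter (cF b).
- by move=> x _; rewrite derive1E; case: (dF x).
Qed.

End real_line.

(** The map need only be measurable on D, so it is extended by a constant
    outside D before taking the push-forward of the restricted measure. *)
Lemma image_measure_exists d1 d2 (T1 : measurableType d1)
    (T2 : measurableType d2) (R : realType) (mu : {measure set T1 -> \bar R})
    (D : set T1) (phi : T1 -> T2) :
  measurable D -> measurable_fun D phi ->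
  exists nu : {measure set T2 -> \bar R},
    (forall B, measurable B -> nu B = mu (D `&` phi @^-1` B)) /\
    forall f : T2 -> \bar R, measurable_fun setT f -> (forall y, 0 <= f y)%E ->
      (\int[nu]_y f y = \int[mu]_(x in D) f (phi x))%E.
Proof.
move=> mD mphi.
have mphi' : measurable_fun setT (phi \_ D) by apply/(measurable_restrictT _ mD).
pose nu : {measure set T2 -> \bar R} :=
  measure_function_pushforward__canonical__measure_function_Measure
    (mrestr mu mD) mphi'.
exists nu; split=> [B mB|f mf f0].
  rewrite /nu/= /pushforward /mrestr [in RHS]setIC; congr (mu _).
  by apply/seteqP; split => x [+ Dx]; rewrite /= patchE mem_set.
rewrite ge0_integral_pushforward//= preimage_setT.
rewrite (@integral_density _ _ _ mu _ (\1_D))//=; last 2 first.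
- exact: measurableT_comp.
- by move=> A mA; rewrite integral_indic// /mrestr setIC.
rewrite [RHS]integral_mkcond; apply: eq_integral => x _.
by rewrite patchE indicE /= patchE; case: ifPn; rewrite ?mule1 ?mule0.
Qed.

Section substitution.
Context {R : realType}.
Notation mu := (@lebesgue_measure R).
Variables F f : R -> R.
Hypothesis dF : forall x, is_derive x (1 : R) F (f x).
Hypothesis cf : continuous f.
Hypothesis incF : {homo F : x y / x < y}.

Let cF : continuous F.
Proof.
move=> x; apply: differentiable_continuous.
by apply/derivable1_diffP; exact: (@ex_derive _ _ _ _ _ _ _ (dF x)).
Qed.

Let leF : {mono F : x y / x <= y}.
Proof. exact: le_mono. Qed.

Let ltF : {mono F : x y / x < y}.
Proof. exact: leW_mono. Qed.

Lemma derive_ge0_of_incr x : 0 <= f x.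
Proof.
case: (dF x) => dFx <-; rewrite -derive1E.
apply: (@incr_derive1_ge0 _ F setT); last by rewrite interiorT.
  by move=> y _; case: (dF y).
by move=> y z _ _; exact: incF.
Qed.

Lemma IVT_incr a b t : F a <= t <= F b -> exists2 c, a <= c <= b & F c = t.
Proof.
move=> /andP[at_ tb].
have ab : a <= b by rewrite -leF (le_trans at_).
have [|c cab Fc] := @IVT R F a b t ab (continuous_subspaceT cF).
  by rewrite (min_idPl _) ?(max_idPr _) ?leF// at_ tb.
by exists c => //; move: cab; rewrite in_itv.
Qed.

Lemma open_range_incr : open (range F).
Proof.
rewrite openE => _ [p _ <-]; rewrite /interior.
near=> t.
have [|c _ <-] := @IVT_incr (p - 1) (p + 1) t; last by exists c.
rewrite !ltW//; near: t.
  by apply: lt_nbhsl; rewrite ltF ltrDl.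
by apply: lt_nbhsr; rewrite ltF gtrBl.
Unshelve. all: by end_near. Qed.

(** The image of Lebesgue measure on the range of F under the inverse of F has
    mass F b - F a on ]a, b], hence has density F' = f. The derivative may
    vanish, so that the inverse of F need not be differentiable. *)
Lemma integral_substitution (h : R -> \bar R) :
  measurable_fun (setT : set (measurableTypeR R)) h -> (forall t, 0 <= h t)%E ->
  (\int[mu]_(t in range F) h t = \int[mu]_p (h (F p) * (f p)%:E))%E.
Proof.
move=> mh h0.
have mrF : measurable (range F) by apply: open_measurable; exact: open_range_incr.
pose G (t : measurableTypeR R) : measurableTypeR R := xget 0 [set p | F p = t].
have FK p : G (F p) = p.
  rewrite /G; case: xgetP => [y _ /= /eqP|/(_ p)/=]; last by case.
  by rewrite eq_le !leF -eq_le => /eqP.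
have mG : measurable_fun (range F) G.
  apply: (measurability _ (RGenOInfty.measurableE R)) => _ [_ [a ->] <-].
  have -> : range F `&` G @^-1` `]a, +oo[ = range F `&` `]F a, +oo[.
    apply/seteqP; split=> _ [[p _ <-]] /=; rewrite FK !in_itv/= !andbT ltF => ?;
      by split=> //; exists p.
  exact: measurableI.
have [m [mE mint]] := @image_measure_exists _ _ _ _ _ mu _ _ mrF mG.
have mF : measurable_fun setT (F : measurableTypeR R -> measurableTypeR R).
  exact: continuous_measurable_fun.
transitivity (\int[mu]_(t in range F) h (F (G t)))%E.
  by apply: eq_integral => _ /[!inE] -[p _ <-]; rewrite FK.
have mhF : measurable_fun setT (h \o F : measurableTypeR R -> \bar R).
  exact: measurableT_comp mh mF.
rewrite -(mint (h \o F))//; last by move=> p; exact: h0.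
apply: integral_density => //.
- exact: continuous_measurable_fun.
- exact: derive_ge0_of_incr.
- by move=> p; exact: h0.
apply: (@measure_by_antiderivative _ F) => // [x|a b ab].
  exact: derive_ge0_of_incr.
rewrite mE//.
have -> : range F `&` G @^-1` `]a, b] = `]F a, F b]%classic.
  apply/seteqP; split=> [_ [[p _ <-]] /=|t /=].
    by rewrite FK !in_itv/= ltF leF.
  rewrite in_itv/= => /andP[at_ tb].
  have [|p _ pt] := @IVT_incr a b t; first by rewrite (ltW at_).
  split; first by exists p.
  by rewrite /= -pt FK in_itv/= -ltF -leF pt at_.
by have := @lebesgue_measure_itv R `]F a, F b]; rewrite /= lte_fin ltF ab.
Qed.

End substitution.

(** * Iterated integration and affine changes of variables *)

Section lebesgue_rV.
Context {R : realType}.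
Notation mu := (@lebesgue_measure R).
Notation leb n := (@lebesgue_rV R n).

Lemma measurable_row_mx d (T : measurableType d) n m
    (f : T -> 'rV[R]_n) (g : T -> 'rV[R]_m) :
  measurable_fun setT f -> measurable_fun setT g ->
  measurable_fun setT (fun x => row_mx (f x) (g x)).
Proof.
move=> /measurable_rVP mf /measurable_rVP mg; apply/measurable_rVP => i; case: (splitP i) => j ij.
  have -> : i = lshift m j by exact/val_inj.
  by under eq_fun do rewrite row_mxEl; exact: mf.
have -> : i = rshift n j by exact/val_inj.
by under eq_fun do rewrite row_mxEr; exact: mg.
Qed.

Lemma integral_row_cons n (H : 'rV[R]_n.+1 -> \bar R) :
  measurable_fun setT H -> (forall x, 0 <= H x)%E ->
  (\int[leb n.+1]_x H x = \int[mu]_t \int[leb n]_y H (row_cons (t, y)))%E.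
Proof.
move=> mH H0; rewrite /=.
rewrite ge0_integral_pushforward//; last exact: measurable_row_cons.
rewrite fubini_tonelli1//; last by move=> x; exact: H0.
by apply: measurableT_comp => //; exact: measurable_row_cons.
Qed.

Lemma row_mx_consA n m (t : R) (y : 'rV[R]_n) (w : 'rV[R]_m) :
  row_cons (t, row_mx y w) = row_mx (row_cons (t, y)) w.
Proof.
rewrite /row_cons/= row_mxA.
by rewrite (_ : esym _ = erefl) ?castmx_id.
Qed.

(** R^(n + m) is the product of R^n and R^m: peel off the coordinates of the
    first factor one at a time. *)
Lemma integral_row_mx n m (H : 'rV[R]_(n + m) -> \bar R) :
  measurable_fun setT H -> (forall x, 0 <= H x)%E ->
  (\int[leb (n + m)]_x H x = \int[leb n]_y \int[leb m]_w H (row_mx y w))%E.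
Proof.
elim: n H => [|n IH] H mH H0.
  have E y : (\int[leb m]_w H (row_mx y w) = \int[leb m]_w H w)%E.
    by apply: eq_integral => w _; rewrite thinmx0 row_thin_mx.
  under [RHS]eq_integral do rewrite E.
  by rewrite integral_cst//= diracT mule1.
rewrite (@integral_row_cons (n + m) H)// integral_row_cons//; last 2 first.
- apply: (@measurable_fun_fubini_tonelli_F _ _ _ _ _ (leb m)
    (fun z => H (row_mx z.1 z.2))) => //.
  by apply: measurableT_comp => //; apply: measurable_row_mx.
- by move=> x; exact: integral_ge0.
apply: eq_integral => t _.
rewrite IH//.
  by apply: eq_integral => y _; apply: eq_integral => w _; rewrite row_mx_consA.
apply: measurableT_comp => //.
apply: (measurableT_comp (@measurable_row_cons R (n + m))).
exact: measurable_fun_pair.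
Qed.

(** One-dimensional substitution in the first coordinate, induction on the
    others. *)
Lemma integral_affine n (a : 'rV[R]_n) (c : R) (H : 'rV[R]_n -> \bar R) :
  0 < c -> measurable_fun setT H -> (forall x, 0 <= H x)%E ->
  (\int[leb n]_x H x = (c ^+ n)%:E * \int[leb n]_x H (a + c *: x)%R)%E.
Proof.
move=> c0; elim: n a H => [|n IH] a H mH H0.
  rewrite expr0 mul1e; apply: eq_integral => x _.
  by congr (H _); rewrite [LHS]thinmx0 [RHS]thinmx0.
pose a0 : R := a 0 0; pose a' : 'rV[R]_n := @rsubmx _ 1 1 n a.
have aE : a = row_cons (a0, a').
  rewrite -[LHS](@hsubmxK _ 1 1 n) /row_cons/=.
  suff -> : @lsubmx _ 1 1 n a = a0%:M by [].
  by apply/rowP => i; rewrite ord1 !mxE eqxx mulr1n; congr (a _ _); exact/val_inj.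
have maff : measurable_fun setT (fun y : 'rV[R]_n => a' + c *: y).
  apply/measurable_rVP => i; under eq_fun do rewrite !mxE.
  by apply: measurable_funD => //; apply: measurable_funM => //; exact: measurable_coord.
have mHt t : measurable_fun setT (fun y : 'rV[R]_n => H (row_cons (t, y))).
  apply: measurableT_comp => //.
  apply: (measurableT_comp (@measurable_row_cons R n)).
  exact: measurable_fun_pair.
pose K t := (\int[leb n]_y H (row_cons (t, (a' + c *: y)%R)))%E.
have mK : measurable_fun (setT : set (measurableTypeR R)) K.
  apply: (@measurable_fun_fubini_tonelli_F _ _ _ _ _ (leb n)
    (fun z => H (row_cons (z.1, a' + c *: z.2)))) => //.
  apply: measurableT_comp => //.
  apply: (measurableT_comp (@measurable_row_cons R n)).
  by apply: measurable_fun_pair => //=; exact: (measurableT_comp maff).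
have K0 t : (0 <= K t)%E by exact: integral_ge0.
rewrite integral_row_cons//.
under eq_integral do rewrite (IH a')// -/(K _).
rewrite ge0_integralZl//; last by rewrite lee_fin exprn_ge0// ltW.
pose F t := a0 + c * t.
have dF x : is_derive x (1 : R) F c.
  by rewrite /F; apply: is_derive_eq; rewrite add0r mul1r /GRing.scale/= mulr1.
have rF : range F = setT.
  apply/seteqP; split=> // t _; exists (c^-1 * (t - a0)) => //.
  by rewrite /F mulrA divff ?gt_eqF// mul1r subrKC.
rewrite -[X in (\int[_]_(x in X) _)%E]rF (integral_substitution _ (fun=> c))//; last 2 first.
- exact: cst_continuous.
- by move=> x y xy; rewrite ltrD2l ltr_pM2l.
rewrite ge0_integralZr//; last 2 first.
- apply: (measurableT_comp mK).
  by apply: measurable_funD => //; exact: measurable_funM.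
- by rewrite lee_fin ltW.
rewrite [in RHS]integral_row_cons//; last first.
  apply: measurableT_comp => //.
  apply/measurable_rVP => i; under eq_fun do rewrite !mxE.
  by apply: measurable_funD => //; apply: measurable_funM => //; exact: measurable_coord.
rewrite exprSr EFinM -muleA; congr (_ * _)%E; rewrite muleC; congr (_ * _)%E.
apply: eq_integral => t _; apply: eq_integral => y _; congr (H _).
rewrite aE /row_cons /F /= raddfD/= -scale_scalar_mx.
by rewrite (@scale_row_mx _ 1 1 n) (@add_row_mx _ 1 1 n).
Qed.

End lebesgue_rV.

(** * The Euclidean norm *)

Section enorm.
Context {R : realType}.
Implicit Types n : nat.

Lemma enorm_ge0 n (x : 'rV[R]_n) : 0 <= enorm x.
Proof. exact: sqrtr_ge0. Qed.

Lemma sqr_enorm n (x : 'rV[R]_n) : enorm x ^+ 2 = \sum_(i < n) x 0 i ^+ 2.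
Proof. by rewrite sqr_sqrtr// sumr_ge0// => i _; exact: sqr_ge0. Qed.

Lemma enormZ n (c : R) (x : 'rV[R]_n) : enorm (c *: x) = `|c| * enorm x.
Proof.
rewrite /enorm -sqrtr_sqr -sqrtrM ?sqr_ge0//; congr Num.sqrt.
by rewrite mulr_sumr; apply: eq_bigr => i _; rewrite mxE exprMn.
Qed.

Lemma coord_le_enorm n (x : 'rV[R]_n) i : `|x 0 i| <= enorm x.
Proof.
rewrite -sqrtr_sqr ler_wsqrtr// (bigD1 i)//= lerDl sumr_ge0// => j _.
exact: sqr_ge0.
Qed.

Lemma enorm_eq0 n (x : 'rV[R]_n) : (enorm x == 0) = (x == 0).
Proof.
apply/eqP/eqP => [x0|->]; last first.
  by rewrite -(scale0r 0) enormZ normr0 mul0r.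
apply/rowP => i; rewrite mxE; apply/eqP.
by rewrite -normr_le0 -x0 coord_le_enorm.
Qed.

Lemma enorm0 n : enorm (0 : 'rV[R]_n) = 0.
Proof. by apply/eqP; rewrite enorm_eq0. Qed.

Lemma enorm_gt0 n (x : 'rV[R]_n) : (0 < enorm x) = (x != 0).
Proof. by rewrite lt_def enorm_ge0 enorm_eq0 andbT. Qed.

Lemma sqr_enorm_row_mx n m (y : 'rV[R]_n) (w : 'rV[R]_m) :
  enorm (row_mx y w) ^+ 2 = enorm y ^+ 2 + enorm w ^+ 2.
Proof.
rewrite !sqr_enorm big_split_ord/=.
by congr (_ + _); apply: eq_bigr => i _; rewrite (row_mxEl, row_mxEr).
Qed.

Lemma continuous_enorm n : continuous (@enorm R n).
Proof.
move=> x; apply: (@continuous_comp _ _ _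
    (fun x : 'rV[R]_n => \sum_(i < n) x 0 i ^+ 2)); last exact: sqrt_continuous.
rewrite /prop_for /continuous_at.
elim: (index_enum _) => [|i s IH].
  rewrite big_nil; under eq_fun do rewrite big_nil.
  exact: cst_continuous.
rewrite big_cons; under eq_fun do rewrite big_cons.
apply: cvgD => //; first exact: (@nbhs_filter 'rV[R]_n x).
apply: (@cvg_comp _ _ _ (fun M : 'rV[R]_n => M 0 i) (fun r : R => r ^+ 2)).
  exact: coord_continuous.
exact: exprn_continuous.
Qed.

Lemma measurable_enorm n :
  measurable_fun setT (@enorm R n : _ -> measurableTypeR R).
Proof.
apply: (measurable_comp measurableT) => //.
  apply: continuous_measurable_fun; exact: sqrt_continuous.
apply: measurable_sum => i; apply: measurable_funX; exact: measurable_coord.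
Qed.

Lemma measurable_scale d (T : measurableType d) n
    (c : T -> measurableTypeR R) (f : T -> 'rV[R]_n) :
  measurable_fun setT c -> measurable_fun setT f ->
  measurable_fun setT (fun x => c x *: f x).
Proof.
move=> mc /measurable_rVP mf; apply/measurable_rVP => i.
under eq_fun do rewrite mxE.
by apply: measurable_funM; [exact: mc|exact: mf].
Qed.

Lemma measurable_neq0 n : measurable [set y : 'rV[R]_n | y != 0].
Proof.
have -> : [set y : 'rV[R]_n | y != 0] = @enorm R n @^-1` [set r | 0 < r].
  by apply/seteqP; split=> y /=; rewrite enorm_gt0.
rewrite -[X in measurable X]setTI; apply: measurable_enorm => //.
have -> : [set r : R | 0 < r] = `]0, +oo[%classic.
  by apply/seteqP; split => r; rewrite /= in_itv/= andbT.
exact: measurable_itv.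
Qed.

Lemma measurable_origin n : measurable [set (0 : 'rV[R]_n)].
Proof.
have -> : [set 0] = ~` [set y : 'rV[R]_n | y != 0].
  by apply/seteqP; split=> y /=; [move=> ->; rewrite eqxx|move/negP/negPn/eqP].
by apply: measurableC; exact: measurable_neq0.
Qed.

End enorm.

(** * Gaussian integrals and the volume of balls *)

Lemma measureE_integral d (T : measurableType d) (R : realType)
    (mu : {measure set T -> \bar R}) (A : set T) : measurable A ->
  mu A = (\int[mu]_x (\1_A x)%:E)%E.
Proof. by move=> mA; rewrite integral_indic// setIT. Qed.

Section ball_volume.
Context {R : realType}.
Notation leb n := (@lebesgue_rV R n).

Lemma sqr_enorm_row_cons n (t : R) (y : 'rV[R]_n) :
  enorm (row_cons (t, y)) ^+ 2 = t ^+ 2 + enorm y ^+ 2.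
Proof.
rewrite (@sqr_enorm_row_mx R 1 n); congr (_ + _).
by rewrite sqr_enorm big_ord1 mxE eqxx mulr1n.
Qed.

Lemma measurable_gaussian n (a : R) : measurable_fun setT
  (fun x : 'rV[R]_n => (expR (- (enorm x / a) ^+ 2))%:E).
Proof.
apply/measurable_EFinP; apply: measurableT_comp => //.
apply: measurableT_comp => //; apply: measurable_funX.
by apply: measurable_funM => //; exact: measurable_enorm.
Qed.

(** After scaling a away, the integrand is the product of n one-dimensional
    Gaussians. *)
Lemma integral_gaussian n (a : R) : 0 < a ->
  (\int[leb n]_x (expR (- (enorm x / a) ^+ 2))%:E
   = ((a * Num.sqrt pi) ^+ n)%:E)%E.
Proof.
move=> a0.
rewrite (@integral_affine _ _ 0 a)//; last exact: measurable_gaussian.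
rewrite exprMn EFinM; congr (_ * _)%E.
under eq_integral => x _.
  rewrite add0r enormZ gtr0_norm// mulrAC divff ?gt_eqF// mul1r; over.
have mG m : measurable_fun setT (fun x : 'rV[R]_m => (expR (- enorm x ^+ 2))%:E).
  by have := @measurable_gaussian m 1; under eq_fun do rewrite divr1.
elim: n => [|n IH]; first by rewrite integral_dirac// diracT mul1e enorm0 expr0n/= oppr0 expR0.
rewrite integral_row_cons//.
under eq_integral => t _.
  under eq_integral => y _.
    rewrite sqr_enorm_row_cons opprD expRD EFinM; over.
  rewrite ge0_integralZl// IH; over.
rewrite /= ge0_integralZr//=.
- by rewrite integralT_gauss exprS.
- by apply/measurable_EFinP; exact: measurable_gauss_fun.
Qed.

Lemma measurable_eball n (x : 'rV[R]_n) (e : R) : measurable (eball x e).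
Proof.
have m1 : measurable_fun setT (fun y : 'rV[R]_n => enorm (y - x) : measurableTypeR R).
  apply: (measurableT_comp (@measurable_enorm R n)); apply/measurable_rVP => i.
  under eq_fun do rewrite !mxE.
  by apply: measurable_funD => //; exact: measurable_coord.
have -> : eball x e = (fun y => enorm (y - x)) @^-1` `]-oo, e[.
  by apply/seteqP; split=> y; rewrite /eball/= in_itv.
by rewrite -[X in measurable X]setTI; exact: m1.
Qed.

(** The ball is the image of the unit ball under an affine map of ratio e. *)
Lemma lebesgue_rV_eball n (x : 'rV[R]_n) (e : R) : 0 < e ->
  lebesgue_rV (eball x e) = ((e ^+ n)%:E * lebesgue_rV (eball (0 : 'rV[R]_n) 1))%E.
Proof.
move=> e0; rewrite !(@measureE_integral _ _ _ (leb n)); try exact: measurable_eball.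
rewrite (@integral_affine _ _ x e)//; last first.
  by apply/measurable_EFinP; apply: measurable_indic; exact: measurable_eball.
congr (_ * _)%E; apply: eq_integral => y _; rewrite !indicE; congr (_ %:R)%:E.
apply: congr1; rewrite /eball; apply/idP/idP; rewrite !inE/= addrAC subrr add0r subr0 enormZ gtr0_norm//;
  by rewrite -ltr_pdivlMl// mulVf ?gt_eqF.
Qed.

(** On the unit ball exp (1 - |x|^2) is at least 1, and its integral is finite. *)
Lemma eball1_lty n : (lebesgue_rV (eball (0 : 'rV[R]_n) 1) < +oo)%E.
Proof.
rewrite (@measureE_integral _ _ _ (leb n)); last exact: measurable_eball.
apply: (@le_lt_trans _ _ (\int[leb n]_x ((expR 1)%:E * (expR (- (enorm x / 1) ^+ 2))%:E))%E).
  apply: ge0_le_integral => //.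
  - by apply/measurable_EFinP; apply: measurable_indic; exact: measurable_eball.
  - by apply: measurable_funeM; exact: measurable_gaussian.
  - move=> x _; rewrite -EFinM lee_fin divr1 -expRD indicE.
    case: (boolP (x \in _)) => [/[!inE]|_]; last exact: expR_ge0.
    rewrite /eball/= subr0 => x1; rewrite -[leLHS]expR0 ler_expR subr_ge0.
    by rewrite expr_le1// ?enorm_ge0// ltW.
rewrite ge0_integralZl ?lee_fin ?expR_ge0//; last exact: measurable_gaussian.
by rewrite integral_gaussian// -EFinM ltry.
Qed.

(** Were the unit ball null, so would be all balls about 0 and their union, in
    contradiction with the positive Gaussian integral. *)
Lemma eball1_gt0 n : (0 < lebesgue_rV (eball (0 : 'rV[R]_n) 1))%E.
Proof.
rewrite lt0e measure_ge0 andbT; apply/eqP => V0.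
have T0 : leb n setT = 0%E.
  have -> : setT = \bigcup_k eball (0 : 'rV[R]_n) k.+1%:R.
    apply/seteqP; split=> // x _; exists (Num.bound (enorm x)) => //.
    rewrite /eball/= subr0 (lt_trans (archi_boundP (enorm_ge0 _ x)))// ltr_nat//.
  apply/negligibleP; first exact: bigcup_measurable (fun k _ => measurable_eball _ _ _).
  apply: negligible_bigcup => k; apply/negligibleP; first exact: measurable_eball.
  by rewrite /= lebesgue_rV_eball// V0 mule0.
have := @integral_gaussian n 1 ltr01.
rewrite (@null_set_integral _ _ _ (leb n) setT)//; last exact: measurable_gaussian.
by move=> /eqP; rewrite eqe mul1r eq_sym expf_eq0 sqrtr_eq0 leNgt pi_gt0 andbF.
Qed.

End ball_volume.

(** * Polar coordinates *)

Lemma sigma_finite_measure_exists d (T : measurableType d) (R : realType)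
    (nu : {measure set T -> \bar R}) : sigma_finite setT nu ->
  exists nu' : {sigma_finite_measure set T -> \bar R},
    nu' = nu :> (set T -> \bar R).
Proof.
move=> sf; pose P A := nu A.
pose M := isMeasure.Build _ _ _ P (measure0 nu) (measure_ge0 nu)
  (@measure_semi_sigma_additive _ _ _ nu).
pose mM : {measure set T -> \bar R} := HB.pack P M.
pose S := Measure_isSigmaFinite.Build _ _ _ mM sf.
by exists (HB.pack P M S : {sigma_finite_measure set T -> \bar R}).
Qed.

Section polar.
Context {R : realType}.
Notation mu := (@lebesgue_measure R).
Notation leb n := (@lebesgue_rV R n).

Lemma exp_density_exists (c : R) : 0 <= c ->
  exists la : {sigma_finite_measure set (measurableTypeR R) -> \bar R},
    forall A, measurable A -> la A = (\int[mu]_(p in A) (c * expR (c * p))%:E)%E.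
Proof.
move=> c0; have mf : measurable_fun setT (fun p : measurableTypeR R => c * expR (c * p)).
  apply: measurable_funM => //; apply: measurableT_comp => //.
have [nu nuE] := @density_measure_exists _ _ _ mu (fun p => (c * expR (c * p))%:E)
  ltac:(exact/measurable_EFinP) ltac:(by move=> x; rewrite lee_fin mulr_ge0 ?expR_ge0).
suff /sigma_finite_measure_exists[la laE] : sigma_finite setT nu.
  by exists la => A mA; rewrite laE nuE.
exists (fun k => `[- k%:R, k%:R]%classic).
  apply/seteqP; split=> // x _; exists (Num.bound `|x|) => //=.
  by rewrite in_itv/= -ler_norml ltW// archi_boundP.
move=> k; split; first exact: measurable_itv.
rewrite nuE; set I := `[_, _]%classic.
have le : (\int[mu]_(p in I) (c * expR (c * p))%:E <=
    \int[mu]_(p in I) (c * expR (c * k%:R))%:E)%E.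
  apply: ge0_le_integral => //.
  - exact: measurable_itv.
  - by move=> x _; rewrite lee_fin mulr_ge0 ?expR_ge0.
  - by apply: measurable_funTS; exact/measurable_EFinP.
  - move=> x; rewrite /I /= in_itv/= => /andP[_ xk].
    by rewrite lee_fin ler_wpM2l// ler_expR ler_wpM2l.
apply: (le_lt_trans le).
rewrite integral_cst; last exact: measurable_itv.
rewrite lte_mul_pinfty ?lee_fin ?mulr_ge0 ?expR_ge0//.
have /= -> := @lebesgue_measure_itv R `[- k%:R, k%:R].
by case: ifPn => _; rewrite -?EFinB ltry.
Qed.

Lemma is_derive_expR_scale (c p : R) :
  is_derive p (1 : R) (fun p => expR (c * p)) (c * expR (c * p)).
Proof.
apply: is_derive_eq.
by rewrite /GRing.scale/= mulr1 mulrC.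
Qed.

(** Since 1 / f = f * (f^2)^(-1), the inverse reduces to a real power of a
    nonnegative function. *)
Lemma measurable_funV d (T : measurableType d) (f : T -> measurableTypeR R) :
  measurable_fun setT f -> measurable_fun setT (fun x => (f x)^-1).
Proof.
move=> mf.
have -> : (fun x => (f x)^-1) = (fun x => f x * ((f x) ^+ 2) `^ (-1)).
  apply/funext => x; rewrite powR_inv1 ?sqr_ge0//.
  have [->|fx0] := eqVneq (f x) 0; first by rewrite invr0 mul0r.
  by rewrite expr2 invfM mulrA divff// mul1r.
apply: measurable_funM => //.
apply: (measurableT_comp (@measurable_powR R (-1))).
exact: measurable_funX.
Qed.

Lemma measurable_direction n :
  measurable_fun setT (fun y : 'rV[R]_n => (enorm y)^-1 *: y).
Proof.
apply: measurable_scale => //.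
by apply: measurable_funV; exact: measurable_enorm.
Qed.

Lemma direction_scale n r (y : 'rV[R]_n) : 0 < r ->
  (enorm (r *: y))^-1 *: (r *: y) = (enorm y)^-1 *: y.
Proof.
move=> r0; rewrite enormZ gtr0_norm// scalerA invfM mulrAC mulVf ?gt_eqF//.
by rewrite mul1r.
Qed.

(** The part at distance at most r of the cone spanned by the directions in C;
    its volume as a function of C is, up to a factor, the surface measure. *)
Definition dir_cone n (r : R) (C : set 'rV[R]_n) : set 'rV[R]_n :=
  [set y | [/\ y != 0, enorm y <= r & C ((enorm y)^-1 *: y)]].

Lemma measurable_dir_cone n r (C : set 'rV[R]_n) :
  measurable C -> measurable (dir_cone n r C).
Proof.
move=> mC.
have -> : dir_cone n r C = [set y | y != 0] `&` (@enorm R n @^-1` `]-oo, r] `&`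
    (fun y => (enorm y)^-1 *: y) @^-1` C).
  apply/seteqP; split=> y /=; first by case=> *; rewrite in_itv.
  by rewrite in_itv/= => -[? []].
apply: measurableI; first exact: measurable_neq0.
apply: measurableI.
  by rewrite -[X in measurable X]setTI; apply: measurable_enorm.
by rewrite -[X in measurable X]setTI; apply: measurable_direction.
Qed.

Lemma lebesgue_rV_dir_cone n r (C : set 'rV[R]_n) : measurable C -> 0 < r ->
  (leb n (dir_cone n r C) = (r ^+ n)%:E * leb n (dir_cone n 1 C))%E.
Proof.
move=> mC r0.
rewrite !(@measureE_integral _ _ _ (leb n)); try exact: measurable_dir_cone.
rewrite (@integral_affine _ _ 0 r)//; last first.
  by apply/measurable_EFinP; apply: measurable_indic; exact: measurable_dir_cone.
congr (_ * _)%E; apply: eq_integral => y _; rewrite !indicE; congr (_ %:R)%:E.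
apply: congr1; rewrite add0r.
have cone_eq : dir_cone n r C (r *: y) = dir_cone n 1 C y.
  apply/propext; rewrite /dir_cone/= direction_scale// scaler_eq0 gt_eqF//=.
  by rewrite enormZ gtr0_norm// -ler_pdivlMl// mulVf ?gt_eqF.
by apply/idP/idP; rewrite !inE cone_eq.
Qed.

End polar.

Section polar.
Context {R : realType}.
Notation mu := (@lebesgue_measure R).
Notation leb n := (@lebesgue_rV R n).

(** The radius is written e^p so that the radial variable ranges over the whole
    line. The image of Lebesgue measure under y |-> (ln |y|, y / |y|) is the
    product of the measure with density n e^(n p) and of the measure [ka]
    giving the volume of the cone over a set of directions: a cone truncated
    at radius e^p has volume e^(n p) times that of its truncation at 1, and
    measures on a product are determined by rectangles. *)
Lemma polar_coordinates n :
  exists ka : {measure set 'rV[R]_n -> \bar R},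
  forall H : 'rV[R]_n -> \bar R, measurable_fun setT H ->
    (forall y, 0 <= H y)%E ->
  (\int[leb n]_(y in [set y | (y != 0)%R]) H y =
   \int[ka]_(th in [set th | enorm th = 1%R])
     \int[mu]_p (H (expR p *: th)%R * (n%:R * expR (n%:R * p))%:E))%E.
Proof.
have mdir := @measurable_direction R n.
have mln : measurable_fun setT (fun y : 'rV[R]_n => ln (enorm y) : measurableTypeR R).
  exact: (measurableT_comp (@measurable_ln R) (@measurable_enorm R n)).
have [M [ME Mint]] := @image_measure_exists _ _ _ (measurableTypeR R * 'rV[R]_n)%type
  _ (leb n) [set y | y != 0] (fun y => (ln (enorm y), (enorm y)^-1 *: y))
  (measurable_neq0 n) ltac:(by apply: measurable_funTS; exact: measurable_fun_pair).
have [ka0 [kaE _]] := @image_measure_exists _ _ _ _ _ (leb n) (dir_cone n 1 setT)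
  (fun y => (enorm y)^-1 *: y) (measurable_dir_cone n 1 setT measurableT)
  ltac:(exact: measurable_funTS).
have {}kaE C : measurable C -> ka0 C = leb n (dir_cone n 1 C).
  move=> mC; rewrite kaE//; congr (leb n _).
  by apply/seteqP; split=> y; [case=> -[]|case=> *; split].
have kafin C : measurable C -> (leb n (dir_cone n 1 C) < +oo)%E.
  move=> mC; apply: (@le_lt_trans _ _ (leb n (eball 0 2))).
    apply: le_measure; rewrite ?inE.
    - exact: measurable_dir_cone.
    - exact: measurable_eball.
    by move=> y [_ y1 _]; rewrite /eball/= subr0 (le_lt_trans y1)// ltr1n.
  by rewrite /= lebesgue_rV_eball// lte_mul_pinfty ?lee_fin ?eball1_lty.
have [ka kaka0] : exists ka : {sigma_finite_measure set 'rV[R]_n -> \bar R},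
    ka = ka0 :> (_ -> _).
  apply: sigma_finite_measure_exists; exists (fun=> setT); first by rewrite bigcup_const.
  by move=> _; split=> //; rewrite kaE// kafin.
have cexp : continuous (fun p : R => n%:R * expR (n%:R * p)).
  move=> x; apply: cvgM; first exact: cvg_cst.
  apply: (cvg_comp (fun p => n%:R * p) expR); last exact: continuous_expR.
  exact: mulrl_continuous.
have [la laE] := @exp_density_exists R n%:R (ler0n _ _).
(* On a rectangle, both sides as functions of A have the antiderivative
   k exp (n p), where k is the volume of the cone over C. *)
have key A C : measurable A -> measurable C -> M (A `*` C) = (la A * ka C)%E.
  move=> mA mC.
  pose k := fine (leb n (dir_cone n 1 C)).
  have kE : leb n (dir_cone n 1 C) = k%:E.
    by rewrite /k fineK// ge0_fin_numE ?kafin// measure_ge0.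
  have k0 : 0 <= k by rewrite fine_ge0// measure_ge0.
  pose DC := [set y : 'rV[R]_n | y != 0] `&` (fun y => (enorm y)^-1 *: y) @^-1` C.
  have mDC : measurable DC.
    apply: measurableI; first exact: measurable_neq0.
    by rewrite -[X in measurable X]setTI; exact: mdir.
  have [m [mE _]] := @image_measure_exists _ _ _ _ _ (leb n) DC
    (fun y => ln (enorm y) : measurableTypeR R) mDC (measurable_funTS mln).
  have -> : M (A `*` C) = m A.
    rewrite ME ?mE//; last exact: measurableX.
    congr (leb n _); apply/seteqP; split=> y.
      by case=> y0 []; do !split.
    by case=> -[]; do !split.
  rewrite kaka0 kaE// kE laE// muleC -ge0_integralZl//; last first.
    apply/measurable_EFinP; apply: measurable_funTS.
    exact: continuous_measurable_fun.
  under eq_integral do rewrite -EFinM.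
  apply: (measure_by_antiderivative (fun p => k * expR (n%:R * p))) => //.
  - move=> p; have := is_deriveZ (k : R) (is_derive_expR_scale n%:R p).
    exact.
  - by move=> x; apply: cvgM; [exact: cvg_cst|exact: (cexp x)].
  - by move=> p; rewrite !mulr_ge0// expR_ge0.
  move=> a b ab; rewrite mE//.
  set X := DC `&` _.
  have mX : measurable X.
    apply: measurableI => //; rewrite -[X in measurable X]setTI; apply: mln => //.
  (* The points with a < ln |y| <= b form a difference of two truncated cones. *)
  have UX : dir_cone n (expR b) C = dir_cone n (expR a) C `|` X.
    have lnE (y : 'rV[R]_n) c : y != 0 -> (enorm y <= expR c) = (ln (enorm y) <= c).
      by move=> y0; rewrite -[in RHS](expRK c) ler_ln// posrE ?expR_gt0 ?enorm_gt0.
    apply/seteqP; split=> y.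
      case=> y0; rewrite lnE// => yb Cy.
      have [ya|ya] := leP (ln (enorm y)) a; [left|right].
        by split=> //; rewrite lnE.
      by split=> //=; rewrite in_itv/= ya.
    case=> [[y0 ya Cy]|[[y0 Cy]/=]].
      by split=> //; rewrite (le_trans ya)// ler_expR ltW.
    by rewrite in_itv/= => /andP[_ yb]; split=> //; rewrite lnE.
  have := congr1 (leb n) UX; rewrite measureU//; last 2 first.
  - exact: measurable_dir_cone.
  - apply/seteqP; split=> // y [[y0 ya _] [_ /=]].
    by rewrite in_itv/= ltNge -ler_expR lnK ?posrE ?enorm_gt0// ya.
  have coneE c : leb n (dir_cone n (expR c) C) = (expR (n%:R * c) * k)%:E.
    by rewrite lebesgue_rV_dir_cone ?expR_gt0// kE -EFinM -expRM_natl.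
  rewrite /= !coneE => E.
  by rewrite ![k * _]mulrC EFinB E addeAC subee// add0e.
exists ka0 => H mH H0.
pose S := [set th : 'rV[R]_n | enorm th = 1].
have mS : measurable S.
  have -> : S = @enorm R n @^-1` [set 1] by [].
  by rewrite -[X in measurable X]setTI; apply: measurable_enorm.
pose K (z : measurableTypeR R * 'rV[R]_n) : \bar R :=
  (H (expR z.1 *: z.2)%R * (\1_S z.2)%:E)%E.
have mK : measurable_fun setT K.
  apply: emeasurable_funM.
    apply: (measurableT_comp mH); apply: measurable_scale => //.
    exact: (measurableT_comp (@measurable_expR R)).
  apply/measurable_EFinP; apply: measurableT_comp => //.
have K0 z : (0 <= K z)%E by rewrite mule_ge0// lee_fin.
transitivity (\int[M]_z K z)%E.
  rewrite Mint//; apply: eq_integral => y /[!inE]/= y0.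
  have e0 : 0 < enorm y by rewrite enorm_gt0.
  rewrite /K /= lnK ?posrE// scalerA divff ?gt_eqF// scale1r indicE mem_set ?mule1//.
  by rewrite /S/= enormZ gtr0_norm ?invr_gt0// mulVf// gt_eqF.
transitivity (\int[(la \x ka)%E]_z K z)%E.
  apply: eq_measure_integral => X mX _; apply/esym/product_measure_unique => // A C mA mC.
rewrite fubini_tonelli2// kaka0 [RHS]integral_mkcond; apply: eq_integral => th _.
rewrite patchE /K /fubini_G/=; case: ifPn => thS; last first.
  by apply: integral0_eq => p _; rewrite indicE (negbTE thS) mule0.
rewrite (@integral_density _ _ _ mu la (fun p => n%:R * expR (n%:R * p)))//.
  by apply: eq_integral => p _; rewrite indicE thS mule1.
- exact: continuous_measurable_fun.
- apply: (measurableT_comp mK (g := fun p => (p, th))).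
  exact: measurable_fun_pair.
- by move=> p; exact: (K0 (p, th)).
Qed.

End polar.

(** * Change of variables along a radial map *)

(** The data of a radial map y |-> s(|y|) y / |y|: s is an increasing C^1
    function on the positive reals with derivative ds. The derivative is
    allowed to vanish. *)
Definition radial_profile (R : realType) (s ds : R -> R) :=
  [/\ forall r, 0 < r -> 0 < s r,
      forall r : R, 0 < r -> is_derive r (1 : R) s (ds r),
      forall r : R, 0 < r -> {for r, continuous ds} &
      forall r1 r2, 0 < r1 -> r1 < r2 -> s r1 < s r2].

Definition profile_map (R : realType) (s : R -> R) n (y : 'rV[R]_n) :=
  (s (enorm y) / enorm y) *: y.

(** The Jacobian determinant at radius r: the map stretches by s' in the radial
    direction and by s r / r in the n - 1 tangential ones. *)
Definition profile_jacobian (R : realType) (s ds : R -> R) n (r : R) : R :=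
  ds r * (s r / r) ^+ n.-1.

Definition profile_range (R : realType) (s : R -> R) : set R :=
  [set s r | r in [set r : R | 0 < r]].

Section profile.
Context {R : realType}.
Variables s ds : R -> R.
Hypothesis prof : radial_profile R s ds.
Notation mu := (@lebesgue_measure R).
Notation leb n := (@lebesgue_rV R n).

Let F p := s (expR p).
Let f p := ds (expR p) * expR p.

Let dF p : is_derive p (1 : R) F (f p).
Proof.
have [_ dS _ _] := prof.
have := @is_derive1_comp _ s expR p _ _ (dS _ (expR_gt0 p)) (is_derive_expR p).
exact.
Qed.

Let cf : continuous f.
Proof.
have [_ _ cds _] := prof; move=> p; apply: cvgM; last exact: continuous_expR.
apply: (cvg_comp expR ds); [exact: continuous_expR|exact/cds/expR_gt0].
Qed.

Let incF : {homo F : x y / x < y}.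
Proof.
have [_ _ _ incs] := prof.
by move=> p q pq; apply: incs; rewrite ?expR_gt0// ltr_expR.
Qed.

(** Composing with exp turns the profile into an increasing function on the
    whole line, to which the substitution rule applies. *)
Lemma profile_rangeE : profile_range R s = range F.
Proof.
apply/seteqP; split=> [_ [r /= r0 <-]|_ [p _ <-]].
  by exists (ln r) => //; rewrite /F lnK.
by exists (expR p) => //=; exact: expR_gt0.
Qed.

Lemma open_profile_range : open (profile_range R s).
Proof. rewrite profile_rangeE; exact: open_range_incr dF incF. Qed.

Lemma measurable_profile_range :
  measurable (profile_range R s : set (measurableTypeR R)).
Proof. by apply: open_measurable; exact: open_profile_range. Qed.

(** The intermediate value theorem for s composed with exp. *)
Lemma profile_IVT a b t : 0 < a -> s a <= t <= s b -> 0 < b ->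
  exists2 r, a <= r <= b & s r = t.
Proof.
move=> a0 tab b0.
have [|p pab <-] := @IVT_incr _ _ _ dF incF (ln a) (ln b) t.
  by rewrite /F !lnK.
exists (expR p) => //.
move: pab => /andP[ap pb].
by rewrite -{1}(lnK a0) ler_expR ap -(lnK b0) ler_expR.
Qed.

Lemma profile_derivative_ge0 r : 0 < r -> 0 <= ds r.
Proof.
move=> r0; have := derive_ge0_of_incr _ _ dF incF (ln r).
by rewrite /f lnK// pmulr_lge0.
Qed.

Lemma ltr_profile a b : 0 < a -> 0 < b -> (s a < s b) = (a < b).
Proof.
have [_ _ _ incs] := prof.
move=> a0 b0; have [ab|ba] := ltP a b; first exact: incs.
apply/negbTE; rewrite -leNgt; move: ba; rewrite le_eqVlt => /predU1P[->//|ba].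
by rewrite ltW// incs.
Qed.

Lemma profile_jacobian_ge0 n r : 0 < r -> 0 <= profile_jacobian R s ds n r.
Proof.
move=> r0; have [s0 _ _ _] := prof.
by rewrite mulr_ge0 ?profile_derivative_ge0// exprn_ge0// divr_ge0// ltW// s0.
Qed.

Lemma enorm_profile_map n (y : 'rV[R]_n) : y != 0 ->
  enorm (profile_map R s n y) = s (enorm y).
Proof.
have [s0 _ _ _] := prof.
move=> y0; have e0 : 0 < enorm y by rewrite enorm_gt0.
by rewrite enormZ ger0_norm ?divr_ge0// ?divfK ?gt_eqF// ltW// s0.
Qed.

Let cs (r : R) : 0 < r -> {for r, continuous s}.
Proof.
have [_ dS _ _] := prof.
move=> r0; apply: differentiable_continuous; apply/derivable1_diffP.
by case: (dS r r0).
Qed.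

Let measurable_on_pos (g : R -> R) n : (forall r : R, 0 < r -> {for r, continuous g}) ->
  measurable_fun [set y : 'rV[R]_n | y != 0] (fun y => g (enorm y) : measurableTypeR R).
Proof.
move=> cg; apply: (@measurable_comp _ _ _ _ (measurableTypeR R) _ `]0, +oo[%classic g).
- exact: measurable_itv.
- by move=> _ [y /= y0 <-]; rewrite in_itv/= andbT enorm_gt0.
- apply: open_continuous_measurable_fun; first exact: interval_open.
  by move=> r; rewrite inE/= in_itv/= andbT; exact: cg.
- by apply: measurable_funTS; exact: measurable_enorm.
Qed.

Lemma measurable_profile_map n :
  measurable_fun [set y : 'rV[R]_n | y != 0] (profile_map R s n).
Proof.
have ms := measurable_on_pos s n cs.
have mD := @measurable_neq0 R n.
apply: (@eq_measurable_fun _ _ _ _ _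
  (fun y => (((fun y => s (enorm y) : measurableTypeR R) \_ [set y | y != 0]) y / enorm y) *: y)).
  by move=> y /[!inE] y0; rewrite patchE mem_set.
apply: measurable_funTS.
apply: measurable_scale => //; apply: measurable_funM.
  by apply/(measurable_restrictT _ mD).
by apply: measurable_funV; exact: measurable_enorm.
Qed.

Lemma continuous_profile_jacobian n (r : R) : 0 < r ->
  {for r, continuous (profile_jacobian R s ds n)}.
Proof.
have [_ _ cds _] := prof.
move=> r0; apply: cvgM; first exact: cds.
apply: (cvg_comp (fun r => s r / r) (fun x => x ^+ n.-1)); last exact: exprn_continuous.
by apply: cvgM; [exact: cs|apply: cvgV; rewrite ?gt_eqF//; exact: cvg_id].
Qed.

Lemma measurable_profile_jacobian n :
  measurable_fun [set y : 'rV[R]_n | y != 0]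
    (fun y => profile_jacobian R s ds n (enorm y) : measurableTypeR R).
Proof. by apply: measurable_on_pos => r; exact: continuous_profile_jacobian. Qed.

Lemma measurable_profile_annulus n :
  measurable [set x : 'rV[R]_n | profile_range R s (enorm x)].
Proof.
rewrite -[X in measurable X]setTI.
by apply: (@measurable_enorm R n) => //; exact: measurable_profile_range.
Qed.

(** In polar coordinates the map acts on the radius alone, so on each ray the
    formula is the one-dimensional substitution t = s (e^p); the tangential
    factor (s r / r)^(n - 1) comes from comparing the weights t^(n - 1) and
    r^(n - 1). *)
Lemma profile_change_of_variables n (H : 'rV[R]_n -> \bar R) : (0 < n)%N ->
  measurable_fun setT H -> (forall x, 0 <= H x)%E ->
  (\int[leb n]_(x in [set x | profile_range R s (enorm x)]) H x =
   \int[leb n]_(y in [set y | (y != 0)%R])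
     (H (profile_map R s n y) * (profile_jacobian R s ds n (enorm y))%:E))%E.
Proof.
move=> n0 mH H0.
have [s0 _ _ _] := prof.
have [ka polar] := polar_coordinates (R := R) n.
set I := profile_range R s; set D := [set y : 'rV[R]_n | y != 0].
have mD : measurable D by exact: measurable_neq0.
have mX := measurable_profile_annulus n.
pose H1 := H \_ [set x : 'rV[R]_n | I (enorm x)].
have mH1 : measurable_fun setT H1.
  by apply/(measurable_restrictT _ mX); exact: measurable_funTS.
have H10 y : (0 <= H1 y)%E by exact: erestrict_ge0.
have Ipos t : I t -> 0 < t by move=> [r r0 <-]; exact: s0.
have -> : (\int[leb n]_(x in [set x | I (enorm x)]) H x =
    \int[leb n]_(x in D) H1 x)%E.
  rewrite integral_mkcond [RHS]integral_mkcond; apply: eq_integral => x _.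
  rewrite /H1 !patchE; case: ifPn => [/[!inE]/Ipos|xI]; last by rewrite if_same.
  by rewrite enorm_gt0 => x0; rewrite mem_set.
pose G0 y := (H (profile_map R s n y) * (profile_jacobian R s ds n (enorm y))%:E)%E.
pose G := G0 \_ D.
have mG : measurable_fun setT G.
  apply/(measurable_restrictT _ mD); apply: emeasurable_funM.
    by apply: (measurable_comp measurableT _ mH) => //; exact: measurable_profile_map.
  apply/measurable_EFinP; exact: measurable_profile_jacobian.
have G00 y : (0 <= G y)%E.
  apply: erestrict_ge0 => {}y; rewrite /D/= => y0.
  by rewrite mule_ge0// lee_fin profile_jacobian_ge0// enorm_gt0.
have -> : (\int[leb n]_(y in D) G0 y = \int[leb n]_(y in D) G y)%E.
  by apply: eq_integral => y yD; rewrite /G patchE yD.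
rewrite !polar//; apply: eq_integral => th /[!inE] th1.
have thp p : enorm (expR p *: th) = expR p.
  by rewrite enormZ th1 mulr1 gtr0_norm ?expR_gt0.
(* The integrand along the ray of direction th, extended by 0 outside the range
   of s, as a function of the radius t. *)
pose h (t : R) : \bar R := (H (t *: th)%R * (\1_I t * (n%:R * t ^+ n.-1))%:E)%E.
have mI : measurable (I : set (measurableTypeR R)) by exact: measurable_profile_range.
have h0 t : (0 <= h t)%E.
  rewrite /h; have [tI|tI] := boolP (t \in I).
    rewrite mule_ge0// lee_fin !mulr_ge0// ?exprn_ge0//.
    by move: tI; rewrite inE => /Ipos/ltW.
  by rewrite indicE (negbTE tI) mul0r mule0.
have mh : measurable_fun (setT : set (measurableTypeR R)) h.
  apply: emeasurable_funM.
    by apply: (measurableT_comp mH); apply: measurable_scale.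
  apply/measurable_EFinP; apply: measurable_funM; first exact: measurable_indic.
  by apply: measurable_funM => //; exact: measurable_funX.
transitivity (\int[mu]_p (h (expR p) * (expR p)%:E))%E.
  apply: eq_integral => p _.
  rewrite /H1 /h patchE -muleA -EFinM.
  have -> : \1_I (expR p) * (n%:R * expR p ^+ n.-1) * expR p
      = \1_I (expR p) * (n%:R * expR (n%:R * p)).
    by rewrite -!mulrA -exprSr prednK// expRM_natl.
  rewrite indicE; have -> : (expR p *: th \in [set x | I (enorm x)]) = (expR p \in I).
    by apply/idP/idP; rewrite !inE/= thp.
  by case: ifPn => _; rewrite ?mul1r// mul0r mule0 mul0e.
rewrite -(integral_substitution expR expR)//; last 2 first.
- exact: continuous_expR.
- by move=> x y xy; rewrite ltr_expR.
transitivity (\int[mu]_(t in range F) h t)%E.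
  rewrite integral_mkcond [RHS]integral_mkcond; apply: eq_integral => t _.
  rewrite -profile_rangeE !patchE -/I; case: ifPn => [_|].
    case: ifPn => // tI.
    by rewrite /h indicE (negbTE tI) mul0r mule0.
  move=> tr; rewrite ifF//; apply/negP; rewrite inE => /Ipos t0.
  by case/negP: tr; rewrite inE; exists (ln t) => //; rewrite lnK.
rewrite (integral_substitution F f dF cf incF)//.
apply: eq_integral => p _.
have p0 : expR p *: th \in D by rewrite inE /D/= -enorm_gt0 thp expR_gt0.
have FI : F p \in I by rewrite inE /I profile_rangeE; exists p.
rewrite /G /h patchE p0 /G0 -!muleA; congr (H _ * _)%E.
  by rewrite /profile_map thp scalerA divfK// gt_eqF ?expR_gt0.
rewrite thp -!EFinM indicE FI mul1r /profile_jacobian /f /F.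
have e0 : expR p != 0 by rewrite gt_eqF ?expR_gt0.
rewrite expRM_natl -[in X in _ = (_ * (_ * expR p ^+ X))%:E](prednK n0).
rewrite exprS expr_div_n; congr EFin.
have en0 : expR p ^+ n.-1 != 0 by rewrite expf_neq0.
by field.
Qed.

End profile.

(** * Radial null sets *)

Section radial_null.
Context {R : realType}.
Notation mu := (@lebesgue_measure R).
Notation leb n := (@lebesgue_rV R n).

(** In polar coordinates the indicator is integrated along each ray over a null
    set of radii. *)
Lemma lebesgue_rV_radial_null n (Z : set (measurableTypeR R)) : (0 < n)%N ->
  measurable Z -> mu Z = 0%E ->
  leb n [set y | y != 0 /\ Z (enorm y)] = 0%E.
Proof.
move=> n0 mZ Z0.
have [ka polar] := polar_coordinates (R := R) n.
set ZY := [set y : 'rV[R]_n | y != 0 /\ Z (enorm y)].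
pose W := [set y : 'rV[R]_n | Z (enorm y)].
have mW : measurable W.
  by rewrite -[X in measurable X]setTI; apply: (@measurable_enorm R n).
have -> : ZY = W `&` [set y | y != 0] by apply/seteqP; split=> y [].
rewrite -integral_indic//; last exact: measurable_neq0.
have mi : measurable_fun setT (fun y : 'rV[R]_n => (\1_W y)%:E : \bar R).
  by apply/measurable_EFinP; exact: measurable_indic.
rewrite polar//.
apply: integral0_eq => th /= th1.
pose h (t : R) : \bar R := (\1_Z t * (n%:R * `|t| ^+ n.-1))%:E.
have mh : measurable_fun (setT : set (measurableTypeR R)) h.
  apply/measurable_EFinP; apply: measurable_funM; first exact: measurable_indic.
  by apply: measurable_funM => //; apply: measurable_funX; exact: normr_measurable.
have h0 t : (0 <= h t)%E by rewrite lee_fin !mulr_ge0// exprn_ge0.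
transitivity (\int[mu]_p (h (expR p) * (expR p)%:E))%E.
  apply: eq_integral => p _; rewrite /h -!EFinM -!mulrA; congr EFin.
  rewrite !indicE (gtr0_norm (expR_gt0 _)) -exprSr prednK// expRM_natl.
  congr (_ %:R * _); congr nat_of_bool.
  by apply/idP/idP; rewrite !inE /W/= enormZ th1 mulr1 gtr0_norm ?expR_gt0.
rewrite -(integral_substitution expR expR)//; last 2 first.
- exact: continuous_expR.
- by move=> x y xy; rewrite ltr_expR.
rewrite (ge0_negligible_integral (N := Z))//.
- apply: integral0_eq => t [_ tZ]; rewrite /h indicE memNset//.
  by rewrite mul0r.
- apply: open_measurable; apply: (open_range_incr expR expR).
  by move=> x y xy; rewrite ltr_expR.
- exact: measurable_funTS.
Qed.

(** The origin is invariant under scaling by 2, which multiplies volumes by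
    2^n; its volume is finite, hence 0. *)
Lemma lebesgue_rV_origin n : (0 < n)%N ->
  leb n [set 0%R] = 0%E.
Proof.
move=> n0.
have m0 : measurable [set (0 : 'rV[R]_n)] := measurable_origin n.
have fin0 : (leb n [set 0%R] < +oo)%E.
  apply: le_lt_trans (eball1_lty n); apply: le_measure; rewrite ?inE//.
    exact: measurable_eball.
  by move=> y ->; rewrite /eball/= subrr enorm0.
have mi : measurable_fun setT (fun y : 'rV[R]_n => (\1_[set 0%R] y)%:E : \bar R).
  by apply/measurable_EFinP; exact: measurable_indic.
have : (leb n [set 0%R] = (2 ^+ n)%:E * leb n [set 0%R])%E.
  rewrite (measureE_integral _ _ _ (leb n))// [LHS](integral_affine _ 0 2)//.
  congr (_ * _)%E; apply: eq_integral => y _; rewrite !indicE; congr (_ %:R)%:E.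
  apply: congr1; apply/idP/idP; rewrite !inE/= add0r => /eqP;
    by rewrite ?scaler_eq0 ?pnatr_eq0/= => /eqP ->; rewrite ?scaler0.
have : leb n [set 0%R] \is a fin_num by rewrite ge0_fin_numE ?measure_ge0.
move=> /fineK <-; rewrite -EFinM => -[] /eqP.
rewrite -subr_eq0 -{1}[fine _]mul1r -mulrBl mulf_eq0 => /orP[|/eqP ->//].
rewrite subr_eq0 -natrX (eqr_nat _ 1) => /eqP H.
by have := ltn_expl n (ltnSn 1); rewrite -H ltnS leqNgt n0.
Qed.

End radial_null.

(** * The density of the image of a radial density *)

(** Euclidean balls are cofinal among the neighbourhoods of the entrywise
    topology because each coordinate is bounded by the Euclidean norm. *)
Lemma eball_nbhs (R : realType) n (x : 'rV[R]_n) (P : set 'rV[R]_n) :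
  nbhs x P -> \forall e \near (0 : R)^'+, eball x e `<=` P.
Proof.
move=> /nbhs_ballP[e /= e0 eP].
near=> r => y yr; apply: eP; split=> // i j; rewrite ord1.
rewrite /ball/= distrC.
have -> : y 0 j - x 0 j = (y - x) 0 j by rewrite !mxE.
apply: le_lt_trans (coord_le_enorm _ _ _) _; apply: lt_trans yr _.
near: r; exact: nbhs_right_lt.
Unshelve. all: by end_near. Qed.

Section inverse.
Context {R : realType}.
Variables s ds sg : R -> R.
Hypothesis prof : radial_profile R s ds.
Hypothesis sgK : forall r, 0 < r -> sg (s r) = r.
Notation mu := (@lebesgue_measure R).
Notation leb n := (@lebesgue_rV R n).

Lemma profile_inverse_gt0 t : profile_range R s t -> 0 < sg t.
Proof. by move=> [r /= r0 <-]; rewrite sgK. Qed.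

Lemma profile_inverseK t : profile_range R s t -> s (sg t) = t.
Proof. by move=> [r /= r0 <-]; rewrite sgK. Qed.

(** An increasing function traps its inverse: on ]s a, s b[ the inverse takes
    values in ]a, b[, for any a < r < b. *)
Lemma continuous_profile_inverse t :
  profile_range R s t -> {for t, continuous sg}.
Proof.
have [_ _ _ incs] := prof.
move=> [r /= r0 <-]; apply/cvgrPdist_lt => e e0; rewrite sgK//.
(* The lower end is kept positive, where s is known to be increasing. *)
pose a := Num.max (r / 2) (r - e).
have a0 : 0 < a by rewrite lt_max divr_gt0.
have ar : a < r by rewrite gt_max gtrBl e0 andbT ltr_pdivrMr// ltr_pMr// ltr1n.
have rb : r < r + e by rewrite ltrDl.
near=> v.
have b0 : 0 < r + e by rewrite addr_gt0.
have lts : s a < v < s (r + e).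
  apply/andP; split; near: v.
    by apply: lt_nbhsr; exact: incs.
  by apply: lt_nbhsl; exact: incs.
have [|u /andP[au ub] ut] := @profile_IVT _ _ _ prof a (r + e) v a0 _ b0.
  by case/andP: lts => /ltW -> /ltW ->.
have u0 : 0 < u by rewrite (lt_le_trans a0).
move: lts; rewrite -ut !(ltr_profile _ _ prof)// sgK// => /andP[{}au {}ub].
rewrite distrC ltr_distl ub andbT (le_lt_trans _ au)// le_max lexx orbT//.
Unshelve. all: by end_near. Qed.

Let measurable_on_annulus (g : R -> R) n :
  (forall t, profile_range R s t -> {for t, continuous g}) ->
  measurable_fun [set x : 'rV[R]_n | profile_range R s (enorm x)]
    (fun x => g (enorm x) : measurableTypeR R).
Proof.
move=> cg.
apply: (@measurable_comp _ _ _ _ (measurableTypeR R) _ (profile_range R s) g).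
- exact: measurable_profile_range _ _ prof.
- by move=> _ [y /= y0 <-].
- apply: open_continuous_measurable_fun; first exact: open_profile_range _ _ prof.
  by move=> r; rewrite inE; exact: cg.
- by apply: measurable_funTS; exact: measurable_enorm.
Qed.

(** The density at x of the image of the radial density f under the map of
    profile s, where [sg] is the inverse of s. The value +oo at critical values
    is the limit of the ratios of mass to volume on small balls. *)
Definition push_density n (f : R -> R) (x : 'rV[R]_n) : \bar R :=
  if enorm x \in profile_range R s then
    if ds (sg (enorm x)) == 0 then +oo%E
    else (f (sg (enorm x)) / profile_jacobian R s ds n (sg (enorm x)))%:E
  else 0%E.

(** The image under the radial map of the measure with density f(|y|), as a
    function of the set A. *)
Definition push_mass n (f : R -> R) (A : set 'rV[R]_n) : \bar R :=
  (\int[leb n]_(y in [set y | (y != 0)%R])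
     (\1_A (profile_map R s n y) * f (enorm y))%:E)%E.

Variables (n : nat) (n_gt0 : (0 < n)%N) (f : R -> R).
Hypothesis f_ge0 : forall r, 0 < r -> 0 <= f r.
Hypothesis mf : measurable_fun setT (f : measurableTypeR R -> measurableTypeR R).

Let D : set 'rV[R]_n := [set y | y != 0].

Let mD : measurable D. Proof. exact: measurable_neq0. Qed.

Lemma measurable_push_integrand (phi : 'rV[R]_n -> R) :
  measurable_fun setT phi ->
  measurable_fun D (fun y => (phi (profile_map R s n y) * f (enorm y))%:E).
Proof.
move=> mphi; apply/measurable_EFinP; apply: measurable_funM.
  apply: (@measurable_comp _ _ _ _ _ _ setT phi) => //.
  exact: measurable_profile_map prof _.
apply: (@measurable_comp _ _ _ _ (measurableTypeR R) _ setT f) => //.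
by apply: measurable_funTS; exact: measurable_enorm.
Qed.

Lemma push_density_ge0 x : (0 <= push_density n f x)%E.
Proof.
rewrite /push_density; case: ifPn => // /[!inE] xI; case: ifPn => // _.
have r0 := profile_inverse_gt0 _ xI.
by rewrite lee_fin divr_ge0 ?f_ge0//; exact: profile_jacobian_ge0 _ _ prof _ _ r0.
Qed.

Lemma measurable_push_density : measurable_fun setT (push_density n f).
Proof.
have [_ dS cds _] := prof.
have mX := measurable_profile_annulus _ _ prof n.
have -> : push_density n f = (fun x => if ds (sg (enorm x)) == 0 then +oo%E
    else (f (sg (enorm x)) / profile_jacobian R s ds n (sg (enorm x)))%:E)
      \_ [set x : 'rV[R]_n | profile_range R s (enorm x)].
  apply/funext => x; rewrite /push_density patchE.
  by have -> : (x \in [set x | profile_range R s (enorm x)]) =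
    (enorm x \in profile_range R s) by apply/idP/idP; rewrite !inE.
apply/(measurable_restrictT _ mX).
have csg := continuous_profile_inverse.
have cdsg t : profile_range R s t -> {for t, continuous (ds \o sg)}.
  move=> It; apply: continuous_comp; first exact: csg.
  exact/cds/profile_inverse_gt0.
have mdsg := measurable_on_annulus (ds \o sg) n cdsg.
have msg := measurable_on_annulus sg n csg.
apply: measurable_fun_if => //.
  by apply: measurable_fun_eqr => //; exact: measurable_cst.
apply/measurable_EFinP; apply: (measurable_funS mX); first by move=> x [].
apply: measurable_funM.
  by apply: (@measurable_comp _ _ _ _ (measurableTypeR R) _ setT f) => //.
apply: (@measurable_comp _ _ _ _ (measurableTypeR R) _ setT (fun t => t^-1)) => //.
  by apply: measurable_funV.
apply: (measurable_on_annulus (profile_jacobian R s ds n \o sg) n).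
move=> t It; apply: continuous_comp; first exact: csg.
exact/(continuous_profile_jacobian _ _ prof)/profile_inverse_gt0.
Qed.

Lemma push_density_profile_map y : y != 0 ->
  (push_density n f (profile_map R s n y) * (profile_jacobian R s ds n (enorm y))%:E
   = (if ds (enorm y) == 0 then 0 else f (enorm y))%:E)%E.
Proof.
have [s0 _ _ _] := prof.
move=> y0; have r0 : 0 < enorm y by rewrite enorm_gt0.
rewrite /push_density (enorm_profile_map _ _ prof)// sgK// mem_set; last by exists (enorm y).
case: ifPn => [/eqP d0|d0].
  by rewrite /profile_jacobian d0 mul0r mule0.
rewrite -EFinM divfK// mulf_neq0// expf_neq0// mulf_neq0 ?invr_neq0// gt_eqF//.
exact: s0.
Qed.

Hypothesis crit : mu [set t | 0 < t /\ ds t = 0] = 0%E.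

(** The change of variables for the density restricted to A. The Jacobian
    cancels the denominator except at the points y with s'(|y|) = 0, a null set
    by the hypothesis on critical radii. *)
Lemma integral_push_density A : measurable A ->
  (\int[leb n]_(x in A) push_density n f x = push_mass n f A)%E.
Proof.
move=> mA.
have mX := measurable_profile_annulus _ _ prof n.
pose H x := (push_density n f x * (\1_A x)%:E)%E.
have mi : measurable_fun setT (fun x : 'rV[R]_n => (\1_A x)%:E : \bar R).
  by apply/measurable_EFinP; exact: measurable_indic.
have mH : measurable_fun setT H.
  by apply: emeasurable_funM => //; exact: measurable_push_density.
have H0 x : (0 <= H x)%E by rewrite mule_ge0 ?push_density_ge0// lee_fin.
transitivity (\int[leb n]_(x in [set x | profile_range R s (enorm x)]) H x)%E.
  rewrite integral_mkcond [RHS]integral_mkcond; apply: eq_integral => x _.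
  rewrite !patchE /H indicE.
  case: ifPn => xA; rewrite ?mule1 ?mule0 ?if_same//.
  case: ifPn => // xI; rewrite /push_density ifF//.
  by apply/negP; rewrite inE => ?; case/negP: xI; rewrite inE.
rewrite (profile_change_of_variables _ _ prof)// -/D.
pose Z : set (measurableTypeR R) := [set t | 0 < t /\ ds t = 0].
have mZ : measurable Z.
  have -> : Z = `]0, +oo[%classic `&` ds @^-1` [set 0].
    by apply/seteqP; split=> t; rewrite /Z /= in_itv/= andbT.
  have mds : measurable_fun (`]0, +oo[%classic : set (measurableTypeR R))
      (ds : measurableTypeR R -> measurableTypeR R).
    apply: open_continuous_measurable_fun; first exact: interval_open.
    by move=> r; rewrite inE/= in_itv/= andbT; case: prof => _ _ + _; apply.
  exact: mds.
pose N : set 'rV[R]_n := [set y | y != 0 /\ Z (enorm y)].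
have N0 : leb n N = 0%E by exact: lebesgue_rV_radial_null.
have mN : measurable N.
  have -> : N = D `&` @enorm R n @^-1` Z by apply/seteqP; split=> y [].
  apply: measurableI => //.
  by rewrite -[X in measurable X]setTI; exact: (@measurable_enorm R n).
have f0 y : D y -> (0 <= (\1_A (profile_map R s n y) * f (enorm y))%:E)%E.
  by move=> y0; rewrite lee_fin mulr_ge0// f_ge0// enorm_gt0.
rewrite /push_mass -/D (ge0_negligible_integral (N := N))//; last 2 first.
- apply: emeasurable_funM.
    by apply: (measurable_comp measurableT _ mH) => //; exact: measurable_profile_map prof _.
  by apply/measurable_EFinP; exact: measurable_profile_jacobian prof _.
- move=> y y0; rewrite mule_ge0// lee_fin (profile_jacobian_ge0 _ _ prof)//.
  by rewrite enorm_gt0.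
rewrite [RHS](ge0_negligible_integral (N := N))//; last first.
  by apply: measurable_push_integrand; exact: measurable_indic.
apply: eq_integral => y /[!inE] -[y0 yN].
rewrite /H muleAC push_density_profile_map// ifF; first by rewrite -EFinM mulrC.
by apply/negP => /eqP d0; apply: yN; split=> //; split=> //; rewrite enorm_gt0.
Qed.

End inverse.

(** * Differentiation along shrinking balls *)

Section ratio.
Context {R : realType}.
Variables s ds sg : R -> R.
Hypothesis prof : radial_profile R s ds.
Hypothesis sgK : forall r, 0 < r -> sg (s r) = r.
Notation leb n := (@lebesgue_rV R n).
Variables (n : nat) (n_gt0 : (0 < n)%N) (f : R -> R).
Hypothesis f_ge0 : forall r, 0 < r -> 0 <= f r.
Hypothesis mf : measurable_fun setT (f : measurableTypeR R -> measurableTypeR R).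
Variables (x : 'rV[R]_n) (r0 : R).
Hypotheses (r0_gt0 : 0 < r0) (xr0 : enorm x = s r0).

Let D : set 'rV[R]_n := [set y | y != 0].
Let mD : measurable D. Proof. exact: measurable_neq0. Qed.
Let V := fine (leb n (eball (0 : 'rV[R]_n) 1)).
Let J := profile_jacobian R s ds n.

Let VE : leb n (eball (0 : 'rV[R]_n) 1) = V%:E.
Proof. by rewrite /V fineK// ge0_fin_numE ?eball1_lty ?measure_ge0. Qed.

Let V_gt0 : 0 < V.
Proof. by have := @eball1_gt0 R n; rewrite VE lte_fin. Qed.

Let rangex : profile_range R s (enorm x).
Proof. by rewrite xr0; exists r0. Qed.

(** Points mapped into a small ball about x have radius close to r0, by
    continuity of the norm and of the inverse profile. *)
Lemma near_ball_preimage (P : set R) : nbhs r0 P ->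
  \forall e \near (0 : R)^'+,
    forall y, y != 0 -> eball x e (profile_map R s n y) -> P (enorm y).
Proof.
move=> Pr0.
have : nbhs x (fun z => P (sg (enorm z))).
  have : {for x, continuous (sg \o @enorm R n)}.
    apply: continuous_comp; first exact: continuous_enorm.
    exact: continuous_profile_inverse prof sgK _ rangex.
  by move=> /(_ P); rewrite /= xr0 sgK//; apply.
move=> /eball_nbhs; apply: filterS => e eP y y0 /eP.
by rewrite (enorm_profile_map _ _ prof)// sgK// enorm_gt0.
Qed.

Let mball e : measurable (eball x e). Proof. exact: measurable_eball. Qed.

Let mJ : measurable_fun D (fun y => J (enorm y) : measurableTypeR R).
Proof. exact: measurable_profile_jacobian prof _. Qed.

Let mball_pm e : measurable_fun D
  (fun y => \1_(eball x e) (profile_map R s n y) : measurableTypeR R).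
Proof.
apply: (@measurable_comp _ _ _ _ _ _ setT (\1_(eball x e) : _ -> measurableTypeR R)) => //.
exact: measurable_profile_map prof _.
Qed.

(** A small ball lies in the range of the radial map, hence its volume is an
    integral of the Jacobian over its preimage. *)
Lemma near_ball_volume : \forall e \near (0 : R)^'+,
  ((e ^+ n * V)%:E = \int[leb n]_(y in D)
     (\1_(eball x e) (profile_map R s n y) * J (enorm y))%:E)%E.
Proof.
have : nbhs x [set z | profile_range R s (enorm z)].
  apply: (continuous_enorm n x (profile_range R s)).
  by apply: open_nbhs_nbhs; split; first exact: open_profile_range prof.
move=> /eball_nbhs near_range.
near=> e.
have e0 : 0 < e by [].
have sub : eball x e `<=` [set z | profile_range R s (enorm z)] by near: e.
rewrite EFinM -VE -(lebesgue_rV_eball _ x _ e0).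
rewrite (measureE_integral _ _ _ (leb n))//.
transitivity (\int[leb n]_(z in [set z : 'rV[R]_n | profile_range R s (enorm z)])
   (\1_(eball x e) z)%:E)%E.
  rewrite [RHS]integral_mkcond; apply: eq_integral => z _; rewrite patchE.
  case: ifPn => // zI; rewrite indicE memNset// => /sub zr.
  by case/negP: zI; rewrite inE.
rewrite (profile_change_of_variables _ _ prof)//.
by apply/measurable_EFinP; exact: measurable_indic.
Unshelve. all: by end_near. Qed.

Let ratio e := (push_mass s n f (eball x e) * ((e ^+ n * V)^-1)%:E)%E.

Let indic_ge0 e y : 0 <= (\1_(eball x e) (profile_map R s n y) : R).
Proof. by rewrite indicE; case: (_ \in _). Qed.

Let J_ge0 y : D y -> 0 <= J (enorm y).
Proof.
by move=> y0; apply: (profile_jacobian_ge0 _ _ prof); rewrite enorm_gt0.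
Qed.

Let mbJ e : measurable_fun D
  (fun y => (\1_(eball x e) (profile_map R s n y) * J (enorm y))%:E).
Proof.
by apply/measurable_EFinP; apply: measurable_funM; [exact: mball_pm|exact: mJ].
Qed.

(** On the preimage of a small ball f is at least K J, and J integrates to the
    volume of the ball. *)
Lemma ball_ratio_ge K : 0 <= K -> (\forall r \near r0, K * J r <= f r) ->
  \forall e \near (0 : R)^'+, (K%:E <= ratio e)%E.
Proof.
move=> K0 KJf; near=> e.
have e0 : 0 < e by [].
have Vn : 0 < e ^+ n * V by rewrite mulr_gt0// exprn_gt0.
have vol : ((e ^+ n * V)%:E = \int[leb n]_(y in D)
  (\1_(eball x e) (profile_map R s n y) * J (enorm y))%:E)%E.
  by near: e; exact: near_ball_volume.
have near_r y : y != 0 -> eball x e (profile_map R s n y) ->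
    K * J (enorm y) <= f (enorm y).
  by move: y; near: e; exact: (near_ball_preimage (fun r => K * J r <= f r)).
rewrite /ratio lee_pdivlMr// vol -ge0_integralZl//; last first.
  move=> y y0; rewrite lee_fin mulr_ge0//.
  exact: J_ge0.
apply: ge0_le_integral => //.
- move=> y y0; rewrite -EFinM lee_fin; apply: mulr_ge0 => //.
  by apply: mulr_ge0 => //; exact: J_ge0.
- by apply: measurable_funeM; exact: mbJ.
- exact: measurable_push_integrand prof _ _ mf _ _.
- move=> y y0; rewrite -EFinM lee_fin mulrCA indicE.
  case: (boolP (_ \in _)) => [/[!inE] yb|_]; last by rewrite !mul0r.
  by rewrite !mul1r near_r.
Unshelve. all: by end_near. Qed.

Lemma ball_ratio_le K : 0 <= K -> (\forall r \near r0, f r <= K * J r) ->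
  \forall e \near (0 : R)^'+, (ratio e <= K%:E)%E.
Proof.
move=> K0 KJf; near=> e.
have e0 : 0 < e by [].
have Vn : 0 < e ^+ n * V by rewrite mulr_gt0// exprn_gt0.
have vol : ((e ^+ n * V)%:E = \int[leb n]_(y in D)
  (\1_(eball x e) (profile_map R s n y) * J (enorm y))%:E)%E.
  by near: e; exact: near_ball_volume.
have near_r y : y != 0 -> eball x e (profile_map R s n y) ->
    f (enorm y) <= K * J (enorm y).
  by move: y; near: e; exact: (near_ball_preimage (fun r => f r <= K * J r)).
rewrite /ratio lee_pdivrMr// vol -ge0_integralZl//; last first.
  move=> y y0; rewrite lee_fin mulr_ge0//.
  exact: J_ge0.
apply: ge0_le_integral => //.
- by move=> y y0; rewrite lee_fin mulr_ge0// f_ge0// enorm_gt0.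
- exact: measurable_push_integrand prof _ _ mf _ _.
- by apply: measurable_funeM; exact: mbJ.
- move=> y y0; rewrite -EFinM lee_fin mulrCA indicE.
  case: (boolP (_ \in _)) => [/[!inE] yb|_]; last by rewrite !mul0r.
  by rewrite !mul1r near_r.
Unshelve. all: by end_near. Qed.

(** The two previous bounds with K slightly below and slightly above
    f r0 / J r0; if J r0 = 0, any K is eventually a lower bound. *)
Lemma ball_ratio_cvg : {for r0, continuous f} -> 0 < f r0 ->
  ratio e @[e --> 0^'+] --> if ds r0 == 0 then +oo%E else (f r0 / J r0)%:E.
Proof.
have [s0 _ _ _] := prof.
move=> cf fr0.
have cJ : {for r0, continuous J} by exact: continuous_profile_jacobian prof _ _ r0_gt0.
case: ifPn => [/eqP d0|d0].
  have J0 : J r0 = 0 by rewrite /J /profile_jacobian d0 mul0r.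
  apply/cvgeyPge => A; pose K := Num.max A 0.
  apply: (@filterS _ _ _ (fun e => (K%:E <= ratio e)%E)).
    by move=> e; apply: le_trans; rewrite lee_fin le_max lexx.
  apply: ball_ratio_ge; first by rewrite le_max lexx orbT.
  have : (f r - K * J r) @[r --> r0] --> f r0 - K * J r0.
    by apply: cvgB => //; apply: cvgM => //; exact: cvg_cst.
  rewrite J0 mulr0 subr0 => /cvgr_gt /(_ _ fr0).
  by apply: filterS => r; rewrite subr_gt0 => /ltW.
have J0 : 0 < J r0.
  rewrite /J /profile_jacobian mulr_gt0// ?exprn_gt0 ?divr_gt0 ?s0//.
  by rewrite lt_neqAle eq_sym d0 (profile_derivative_ge0 _ _ prof).
pose L := f r0 / J r0.
have L0 : 0 < L by rewrite divr_gt0.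
have near_ge e : 0 < e -> \forall t \near (0 : R)^'+, ((L - e)%:E <= ratio t)%E.
  move=> e0; pose K := Num.max (L - e) 0.
  apply: (@filterS _ _ _ (fun e => (K%:E <= ratio e)%E)).
    by move=> t; apply: le_trans; rewrite lee_fin le_max lexx.
  apply: ball_ratio_ge; first by rewrite le_max lexx orbT.
  have : (f r - K * J r) @[r --> r0] --> f r0 - K * J r0.
    by apply: cvgB => //; apply: cvgM => //; exact: cvg_cst.
  have : 0 < f r0 - K * J r0.
    by rewrite subr_gt0 -ltr_pdivlMr// -/L gt_max L0 gtrBl e0.
  move=> pos /cvgr_gt /(_ _ pos).
  by apply: filterS => r; rewrite subr_gt0 => /ltW.
have near_le e : 0 < e -> \forall t \near (0 : R)^'+, (ratio t <= (L + e)%:E)%E.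
  move=> e0; apply: ball_ratio_le; first by rewrite addr_ge0 ?ltW.
  have : ((L + e) * J r - f r) @[r --> r0] --> (L + e) * J r0 - f r0.
    by apply: cvgB => //; apply: cvgM => //; exact: cvg_cst.
  have : 0 < (L + e) * J r0 - f r0.
    by rewrite subr_gt0 -ltr_pdivrMr// -/L ltrDl.
  move=> pos /cvgr_gt /(_ _ pos).
  by apply: filterS => r; rewrite subr_gt0 => /ltW.
have near_fin : \forall t \near (0 : R)^'+, ratio t \is a fin_num.
  near=> t; rewrite fin_numE; apply/andP; split.
    rewrite gt_eqF// (lt_le_trans (ltNyr (L - 1)))//.
    by near: t; exact: near_ge.
  rewrite lt_eqF// (le_lt_trans _ (ltry (L + 1)))//.
  by near: t; exact: near_le.
apply/fine_cvgP; split=> //; apply/cvgrPdist_le => e e0; near=> t.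
have tfin : ratio t \is a fin_num by near: t.
rewrite /= ler_distlC -!lee_fin fineK//; apply/andP; split; near: t.
  exact: near_ge.
exact: near_le.
Unshelve. all: by end_near. Qed.

End ratio.

(** * Derivative of the inverse profile *)

Section ederive.
Context {R : realType}.
Variables s ds sg : R -> R.
Hypothesis prof : radial_profile R s ds.
Hypothesis sgK : forall r, 0 < r -> sg (s r) = r.

(** The difference quotients of the inverse are the inverses of those of s,
    taken at an increment that tends to 0 without vanishing. The quotients of
    s are positive, so that their inverses tend to +oo if s' vanishes. *)
Lemma ederive1_profile_inverse r0 : 0 < r0 ->
  ederive1 sg (s r0) = if ds r0 == 0 then +oo%E else ((ds r0)^-1)%:E.
Proof.
have [_ dS _ incs] := prof.
move=> r0_gt0.
have rng : profile_range R s (s r0) by exists r0.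
pose k h := sg (h + s r0) - r0.
pose Q u : R := u^-1 * (s (u + r0) - s r0).
have hlim : (h + s r0) @[h --> 0^'] --> s r0.
  rewrite -[X in _ --> X]add0r; apply: cvgD; last exact: cvg_cst.
  exact: cvg_within.
have k0 : k h @[h --> 0^'] --> (0 : R).
  have : sg (h + s r0) @[h --> 0^'] --> sg (s r0).
    apply: (cvg_comp (fun h => h + s r0) sg); first exact: hlim.
    exact: continuous_profile_inverse prof sgK _ rng.
  by rewrite sgK// -(subrr r0) => ?; apply: cvgB => //; exact: cvg_cst.
have near_range : \forall h \near 0^', profile_range R s (h + s r0).
  apply: (hlim (profile_range R s)); apply: open_nbhs_nbhs; split => //.
  exact: open_profile_range prof.
have kneq0 : \forall h \near 0^', k h != 0.
  near=> h; rewrite /k subr_eq0; apply/eqP => E.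
  have hr : profile_range R s (h + s r0) by near: h.
  have := profile_inverseK _ _ sgK _ hr; rewrite E.
  move/eqP; rewrite eq_sym -subr_eq0 addrK; apply/negP.
  by near: h; exact: nbhs_dnbhs_neq.
have klim : k h @[h --> 0^'] --> (0 : R)^'.
  move=> P P0; have kP : \forall h \near 0^', k h != 0 -> P (k h) by exact: k0 P0.
  by apply: filterS2 kP kneq0 => h; exact.
have Qlim : Q u @[u --> 0^'] --> ds r0.
  have [drv <-] := dS r0 r0_gt0.
  rewrite (_ : Q = fun h => h^-1 *: ((s \o shift r0) (h *: (1 : R)) - s r0)) //.
  by apply/funext => u; rewrite /Q /= /GRing.scale/= mulr1.
have QK : \forall h \near 0^', h^-1 * (sg (h + s r0) - sg (s r0)) = (Q (k h))^-1.
  near=> h.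
  have hr : profile_range R s (h + s r0) by near: h.
  rewrite sgK// /Q /k subrK (profile_inverseK _ _ sgK)// addrK.
  by rewrite invfM invrK mulrC.
have Qkpos : \forall h \near 0^', 0 < Q (k h).
  near=> h.
  have hr : profile_range R s (h + s r0) by near: h.
  have kh : k h != 0 by near: h.
  rewrite /Q /k subrK.
  have := profile_inverse_gt0 _ _ sgK _ hr; set u := sg _ => u0.
  have [uk|uk|E] := ltgtP u r0.
  - by rewrite nmulr_rgt0 ?invr_lt0 ?subr_lt0// incs.
  - by rewrite pmulr_rgt0 ?invr_gt0 ?subr_gt0// incs.
  - by move: kh; rewrite /k -/u E subrr eqxx.
have Qklim : Q (k h) @[h --> 0^'] --> ds r0.
  exact: cvg_comp klim Qlim.
rewrite /ederive1; apply/cvg_lim; first exact: ereal_hausdorff.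
case: ifPn => [/eqP d0|d0]; last first.
  apply: cvg_EFin; first by near=> h.
  apply: cvg_trans (cvgV d0 Qklim).
  apply: near_eq_cvg; near=> h => /=; apply/esym.
  by near: h.
(* Maximum with 1 so that K can be inverted. *)
apply/cvgeyPge => A; pose K := Num.max A 1.
have K0 : 0 < K by rewrite lt_max ltr01 orbT.
near=> h.
have -> : h^-1 * (sg (h + s r0) - sg (s r0)) = (Q (k h))^-1 by near: h.
rewrite lee_fin (@le_trans _ _ K) ?le_max ?lexx//.
have Qp : 0 < Q (k h) by near: h.
rewrite -[K]invrK lef_pV2 ?posrE ?invr_gt0//; near: h.
move: Qklim; rewrite d0 => /cvgr_le; apply.
by rewrite invr_gt0.
Unshelve. all: by end_near. Qed.

End ederive.

(** * Marginals of the cone measure on the sphere *)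

Section sphere_projection.
Context {R : realType}.

(** If |u| = r and |w| = t, the point (u, w) rescaled to norm c has its first
    block at distance c r / sqrt (r^2 + t^2) from the origin. *)
Definition slice_profile (c t r : R) : R := c * r / Num.sqrt (r ^+ 2 + t ^+ 2).
Definition slice_derivative (c t r : R) : R :=
  c * t ^+ 2 / Num.sqrt (r ^+ 2 + t ^+ 2) ^+ 3.

Lemma slice_radial_profile c t : 0 < c -> 0 < t ->
  radial_profile R (slice_profile c t) (slice_derivative c t).
Proof.
move=> c0 t0.
have q0 r : 0 < r ^+ 2 + t ^+ 2 by rewrite ltr_wpDl ?sqr_ge0// exprn_gt0.
have sq0 r : 0 < Num.sqrt (r ^+ 2 + t ^+ 2) by rewrite sqrtr_gt0.
have dS (r : R) : is_derive r (1 : R) (slice_profile c t) (slice_derivative c t r).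
  have h1 : is_derive r (1 : R) (fun r : R => r ^+ 2 + t ^+ 2) (2 * r).
    by apply: is_derive_eq; rewrite addr0 /GRing.scale/= mulr1 mulr_natl.
  have h2 := @is_derive1_comp _ Num.sqrt _ r _ _ (is_derive1_sqrt (q0 r)) h1.
  have h3 := @is_deriveV _ (fun r : R => Num.sqrt (r ^+ 2 + t ^+ 2)) r _ 1
    (lt0r_neq0 (sq0 r)) h2.
  have h4 := is_deriveM (is_deriveZ c (is_derive_id r (1 : R))) h3.
  apply: (is_derive_eq (h4 : is_derive r 1 (slice_profile c t) _)).
  rewrite /= /slice_derivative /GRing.scale/=.
  have q0' := sq0 r; set q := Num.sqrt _ in q0' *.
  have -> : t ^+ 2 = q ^+ 2 - r ^+ 2 by rewrite /q sqr_sqrtr ?ltW// addrAC subrr add0r.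
  by field; rewrite gt_eqF.
split.
- by move=> r r0; rewrite /slice_profile divr_gt0 ?mulr_gt0.
- by move=> r r0; exact: dS.
- move=> r r0; apply: cvgM; first exact: cvg_cst.
  have cq : {for r, continuous (fun r : R => Num.sqrt (r ^+ 2 + t ^+ 2))}.
    apply: (@continuous_comp _ _ _ (fun r : R => r ^+ 2 + t ^+ 2) Num.sqrt); last exact: sqrt_continuous.
    by apply: cvgD; [exact: exprn_continuous|exact: cvg_cst].
  apply: cvgV; first by rewrite expf_neq0// gt_eqF.
  apply: (cvg_comp (fun r : R => Num.sqrt (r ^+ 2 + t ^+ 2)) (fun x => x ^+ 3)); first exact: cq.
  exact: exprn_continuous.
- move=> r1 r2 r10 r12; rewrite /slice_profile -!mulrA ltr_pM2l//.
  have r20 := lt_trans r10 r12.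
  rewrite ltr_pdivrMr// mulrAC ltr_pdivlMr//.
  rewrite -ltr_sqr ?nnegrE ?mulr_ge0 ?ltW//.
  have r12sq : r1 ^+ 2 < r2 ^+ 2 by rewrite ltr_sqr ?nnegrE ?ltW.
  have t2 : 0 < t ^+ 2 by rewrite exprn_gt0.
  by rewrite !exprMn !sqr_sqrtr ?ltW//; nra.
Qed.

End sphere_projection.

Section sphere_projection.
Context {R : realType}.
Notation leb n := (@lebesgue_rV R n).

(** On the sphere of radius c, a point whose first block has norm z has a
    second block of norm c times this number. *)
Definition cap_height (c z : R) : R := Num.sqrt (1 - (z / c) ^+ 2).

Lemma measurable_cap_height (c : R) :
  measurable_fun setT (cap_height c : measurableTypeR R -> measurableTypeR R).
Proof.
apply: (measurableT_comp (f := @Num.sqrt R)).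
  by apply: continuous_measurable_fun; exact: sqrt_continuous.
apply: measurable_funB => //; apply: measurable_funX.
by apply: measurable_funM.
Qed.

(** The density at distance z of the image, under the radial map of profile
    [slice_profile c t], of Lebesgue measure on the slice r^2 + t^2 < 1 of the
    unit ball; see [slice_density_jacobian]. *)
Definition slice_density (c : R) n (t z : R) : R :=
  if (z < c) && (t < cap_height c z)
  then t ^+ n / (c ^+ n * cap_height c z ^+ n.+2) else 0.

Lemma slice_range (c t : R) : 0 < c -> 0 < t ->
  profile_range R (slice_profile c t) = `]0, c[%classic.
Proof.
move=> c0 t0.
have q0 r : 0 < r ^+ 2 + t ^+ 2 by rewrite ltr_wpDl ?sqr_ge0// exprn_gt0.
have sq0 r : 0 < Num.sqrt (r ^+ 2 + t ^+ 2) by rewrite sqrtr_gt0.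
apply/seteqP; split=> [_ [r /= r0 <-]|z /=]; rewrite in_itv/=.
  rewrite /slice_profile divr_gt0 ?mulr_gt0//= ltr_pdivrMr// ltr_pM2l//.
  by rewrite -{1}[r]gtr0_norm// -sqrtr_sqr ltr_sqrt// ltrDl exprn_gt0.
move=> /andP[z0 zc].
have cz : 0 < c ^+ 2 - z ^+ 2 by rewrite subr_gt0 ltr_sqr ?nnegrE ?ltW.
exists (t * z / Num.sqrt (c ^+ 2 - z ^+ 2)) => /=.
  by rewrite divr_gt0 ?mulr_gt0 ?sqrtr_gt0.
rewrite /slice_profile exprMn exprVn sqr_sqrtr ?ltW//.
have -> : (t * z) ^+ 2 / (c ^+ 2 - z ^+ 2) + t ^+ 2 = (t * c) ^+ 2 / (c ^+ 2 - z ^+ 2).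
  by field; rewrite gt_eqF.
rewrite sqrtrM ?sqr_ge0// sqrtr_sqr sqrtrV ?ltW// ger0_norm ?mulr_ge0 ?ltW//.
have : 0 < Num.sqrt (c ^+ 2 - z ^+ 2) by rewrite sqrtr_gt0.
set q := Num.sqrt _ => qq; field.
by rewrite !gt_eqF.
Qed.

Lemma cap_height_slice (c t r : R) : 0 < c -> 0 < t ->
  cap_height c (slice_profile c t r) = t / Num.sqrt (r ^+ 2 + t ^+ 2).
Proof.
move=> c0 t0.
have q0 : 0 < r ^+ 2 + t ^+ 2 by rewrite ltr_wpDl ?sqr_ge0// exprn_gt0.
rewrite /cap_height /slice_profile mulrC !mulrA mulVf ?gt_eqF// mul1r.
rewrite exprMn exprVn sqr_sqrtr ?ltW//.
have -> : 1 - r ^+ 2 / (r ^+ 2 + t ^+ 2) = t ^+ 2 / (r ^+ 2 + t ^+ 2).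
  by field; rewrite gt_eqF.
by rewrite sqrtrM ?sqr_ge0// sqrtr_sqr sqrtrV ?ltW// ger0_norm ?ltW.
Qed.

(** With q = sqrt (r^2 + t^2), the cap height at the image is t / q and the
    Jacobian is c^n t^2 / q^(n + 2), so the product is 1 on the slice. *)
Lemma slice_density_jacobian (c t r : R) n : (0 < n)%N -> 0 < c -> 0 < t -> 0 < r ->
  slice_density c n t (slice_profile c t r) *
    profile_jacobian R (slice_profile c t) (slice_derivative c t) n r =
  if r ^+ 2 + t ^+ 2 < 1 then 1 else 0.
Proof.
move=> n0 c0 t0 r0.
have q0 : 0 < r ^+ 2 + t ^+ 2 by rewrite ltr_wpDl ?sqr_ge0// exprn_gt0.
have sq0 : 0 < Num.sqrt (r ^+ 2 + t ^+ 2) by rewrite sqrtr_gt0.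
have sc : slice_profile c t r < c.
  have : profile_range R (slice_profile c t) (slice_profile c t r) by exists r.
  by rewrite slice_range//= in_itv/= => /andP[].
rewrite /slice_density sc/= cap_height_slice//.
have -> : (t < t / Num.sqrt (r ^+ 2 + t ^+ 2)) = (r ^+ 2 + t ^+ 2 < 1).
  rewrite ltr_pdivlMr// gtr_pMr// -[X in _ < X]sqrtr1 ltr_sqrt//.
case: ifPn => _; last by rewrite mul0r.
rewrite /profile_jacobian /slice_derivative /slice_profile.
move: sq0; set q := Num.sqrt _ => sq0.
have -> : c * r / q / r = c / q by field; rewrite !gt_eqF.
case: n n0 => // n _ /=.
rewrite !expr_div_n.
have qn : q ^+ n != 0 by rewrite expf_neq0// gt_eqF.
have cn : c ^+ n != 0 by rewrite expf_neq0// gt_eqF.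
have tn : t ^+ n != 0 by rewrite expf_neq0// gt_eqF.
rewrite !exprS.
by field; rewrite qn cn tn !gt_eqF.
Qed.

Lemma slice_density_ge0 (c t z : R) n : 0 <= c -> 0 <= t -> 0 <= slice_density c n t z.
Proof.
move=> c0 t0; rewrite /slice_density; case: ifPn => // _.
apply: divr_ge0; first exact: exprn_ge0.
by apply: mulr_ge0; apply: exprn_ge0 => //; exact: sqrtr_ge0.
Qed.

Lemma measurable_slice_density d (T : measurableType d) (c : R) n
    (t z : T -> measurableTypeR R) :
  measurable_fun setT t -> measurable_fun setT z ->
  measurable_fun setT (fun x => slice_density c n (t x) (z x)).
Proof.
move=> mt mz.
have mb := measurableT_comp (measurable_cap_height c) mz.
apply: measurable_fun_ifT => //.
  apply: measurable_and; first exact: measurable_fun_ltr.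
  exact: measurable_fun_ltr.
apply: measurable_funM; first exact: measurable_funX.
apply: measurable_funV; apply: measurable_funM => //.
exact: measurable_funX.
Qed.

(** Up to the factor [radial_moment], the density at distance z of the first
    block of the points of the unit ball rescaled to norm c. The exponents
    n + m and n + 2 are kept apart because their difference is negative when
    m = 1. *)
Definition fibre_mass (c : R) n m (z : R) : R :=
  if z < c then cap_height c z ^+ (n + m) / (c ^+ n * cap_height c z ^+ n.+2) else 0.

Definition radial_moment n m : \bar R :=
  (\int[leb m]_w (enorm w ^+ n * (if enorm w < 1 then 1 else 0))%:E)%E.

(** Rescaling w by the cap height b turns the domain |w| < b into the unit ball
    and brings out the factor b^(n + m). *)
Lemma integral_slice_density (c z : R) n m : 0 < c -> 0 <= z ->
  (\int[leb m]_w (slice_density c n (enorm w) z)%:E =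
   (fibre_mass c n m z)%:E * radial_moment n m)%E.
Proof.
move=> c0 z0; rewrite /slice_density /fibre_mass.
have [zc|cz] /= := ltP z c; last first.
  by rewrite mul0e integral0_eq.
set b := cap_height c z.
have b0 : 0 < b.
  rewrite /b sqrtr_gt0 subr_gt0 expr_lt1 ?divr_ge0 ?(ltW c0)//.
  by rewrite ltr_pdivrMr// mul1r.
pose a := (c ^+ n * b ^+ n.+2)^-1.
have a0 : 0 <= a by rewrite invr_ge0 mulr_ge0// exprn_ge0// ltW.
have mi (e : R) : measurable_fun setT
    (fun w : 'rV[R]_m => (enorm w ^+ n * (if enorm w < e then 1 else 0))%:E : \bar R).
  apply/measurable_EFinP; apply: measurable_funM.
    by apply: measurable_funX; exact: measurable_enorm.
  apply: measurable_fun_ifT => //.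
  by apply: measurable_fun_ltr => //; exact: measurable_enorm.
have i0 (e : R) (w : 'rV[R]_m) : (0 <= (enorm w ^+ n * (if enorm w < e then 1 else 0))%:E)%E.
  by rewrite lee_fin mulr_ge0 ?exprn_ge0 ?enorm_ge0//; case: ifP.
transitivity (a%:E * \int[leb m]_w (enorm w ^+ n * (if enorm w < b then 1 else 0))%:E)%E.
  rewrite -ge0_integralZl//.
  apply: eq_integral => w _; rewrite -EFinM; congr EFin.
  by case: ifP => _; rewrite ?mulr1 ?mulr0// mulrC.
rewrite (integral_affine _ 0 b)// muleA -EFinM.
under eq_integral => w _.
  rewrite add0r enormZ gtr0_norm// exprMn -mulrA gtr_pMr// EFinM; over.
rewrite ge0_integralZl ?lee_fin ?exprn_ge0 ?ltW// muleA -EFinM /radial_moment.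
by congr (_%:E * _)%E; rewrite -mulrA -exprD addnC mulrC.
Qed.

(** The integrand is at most the indicator of the unit ball. *)
Lemma radial_moment_fin n m : (0 < m)%N -> radial_moment n m \is a fin_num.
Proof.
move=> m0; rewrite ge0_fin_numE; last first.
  by apply: integral_ge0 => w _; rewrite lee_fin mulr_ge0 ?exprn_ge0 ?enorm_ge0//; case: ifP.
apply: le_lt_trans (eball1_lty m).
rewrite (measureE_integral _ _ _ (leb m)); last exact: measurable_eball.
apply: ge0_le_integral => //.
- by move=> w _; rewrite lee_fin mulr_ge0 ?exprn_ge0 ?enorm_ge0//; case: ifP.
- apply/measurable_EFinP; apply: measurable_funM.
    by apply: measurable_funX; exact: measurable_enorm.
  apply: measurable_fun_ifT => //.
  by apply: measurable_fun_ltr => //; exact: measurable_enorm.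
- by apply/measurable_EFinP; apply: measurable_indic; exact: measurable_eball.
- move=> w _; rewrite lee_fin indicE.
  have -> : (w \in eball 0 1) = (enorm w < 1).
    by apply/idP/idP; rewrite inE /eball/= subr0.
  case: ifP => w1; rewrite ?mulr0// mulr1/=.
  by rewrite exprn_ile1 ?enorm_ge0// ltW.
Qed.

Lemma fibre_mass_ge0 (c z : R) n m : 0 <= c -> 0 <= fibre_mass c n m z.
Proof.
move=> c0; rewrite /fibre_mass; case: ifPn => // _.
apply: divr_ge0; first by apply: exprn_ge0; exact: sqrtr_ge0.
by apply: mulr_ge0; apply: exprn_ge0 => //; exact: sqrtr_ge0.
Qed.

Lemma measurable_fibre_mass (c : R) n m :
  measurable_fun setT (fibre_mass c n m : measurableTypeR R -> measurableTypeR R).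
Proof.
have mb : measurable_fun setT (cap_height c : measurableTypeR R -> measurableTypeR R) :=
  measurable_cap_height c.
apply: measurable_fun_ifT => //; first exact: measurable_fun_ltr.
apply: measurable_funM; first exact: measurable_funX.
apply: measurable_funV; apply: measurable_funM => //.
exact: measurable_funX.
Qed.

Lemma integral_neq0 n (g : 'rV[R]_n -> \bar R) : (0 < n)%N ->
  measurable_fun setT g -> (forall x, 0 <= g x)%E ->
  (\int[leb n]_x g x = \int[leb n]_(x in [set x | (x != 0)%R]) g x)%E.
Proof.
move=> n0 mg g0.
have m0 : measurable [set (0 : 'rV[R]_n)] := measurable_origin n.
rewrite (ge0_negligible_integral (N := [set (0 : 'rV[R]_n)]))//; last exact: lebesgue_rV_origin.
by congr integral; apply/seteqP; split=> y /=; [case=> _ /eqP|move/eqP].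
Qed.

Lemma cone_point_row_mx n m (c : R) (u : 'rV[R]_n) (w : 'rV[R]_m) :
  (c / enorm (row_mx u w) *: row_mx u w) *m pid_mx n =
  (c / Num.sqrt (enorm u ^+ 2 + enorm w ^+ 2)) *: u.
Proof.
rewrite -sqr_enorm_row_mx sqrtr_sqr ger0_norm ?enorm_ge0//.
by rewrite -scalemxAl pid_mx_col mul_row_col mulmx1 mulmx0 addr0.
Qed.

(** The change of variables along the radial map of profile [slice_profile c t],
    whose range is the punctured ball of radius c. *)
Lemma slice_integral n (c : R) (B : set 'rV[R]_n) t : (0 < n)%N -> 0 < c -> 0 < t ->
  measurable B ->
  (\int[leb n]_u (\1_B ((c / Num.sqrt (enorm u ^+ 2 + t ^+ 2)) *: u)%R *
      (if (enorm u ^+ 2 + t ^+ 2 < 1)%R then 1 else 0))%:E =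
   \int[leb n]_z (\1_(B `&` [set z | (z != 0)%R]) z *
      slice_density c n t (enorm z))%:E)%E.
Proof.
move=> n0 c0 t0 mB.
set D := [set z : 'rV[R]_n | z != 0].
have mD : measurable D := measurable_neq0 n.
have prof := slice_radial_profile _ _ c0 t0.
pose H (z : 'rV[R]_n) : \bar R := (\1_B z * slice_density c n t (enorm z))%:E.
have mH : measurable_fun setT H.
  apply/measurable_EFinP; apply: measurable_funM; first exact: measurable_indic.
  by apply: measurable_slice_density => //; exact: measurable_enorm.
have H0 z : (0 <= H z)%E by rewrite lee_fin mulr_ge0// slice_density_ge0// ltW.
have ms : measurable_fun setT (fun u : 'rV[R]_n => enorm u ^+ 2 + t ^+ 2 : measurableTypeR R).
  apply: measurable_funD => //; apply: measurable_funX; exact: measurable_enorm.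
rewrite integral_neq0//; last 2 first.
- apply/measurable_EFinP; apply: measurable_funM.
    apply: (measurableT_comp (f := \1_B : _ -> measurableTypeR R)) => //.
    apply: measurable_scale => //; apply: measurable_funM => //.
    apply: measurable_funV; apply: (measurableT_comp (f := @Num.sqrt R)) => //.
    by apply: continuous_measurable_fun; exact: sqrt_continuous.
  by apply: measurable_fun_ifT => //; exact: measurable_fun_ltr.
- by move=> u; rewrite lee_fin mulr_ge0//; case: ifP.
transitivity (\int[leb n]_(z in D) H z)%E; last first.
  rewrite integral_mkcond; apply: eq_integral => z _.
  rewrite patchE /H !indicE in_setI.
  by case: (z \in D); rewrite ?andbT ?andbF// mul0r.
transitivity (\int[leb n]_(z in [set z : 'rV[R]_n |
    profile_range R (slice_profile c t) (enorm z)]) H z)%E; last first.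
  rewrite integral_mkcond [RHS]integral_mkcond; apply: eq_integral => z _.
  rewrite !patchE.
  have [zD|zD] := boolP (z \in D); last first.
    rewrite memNset// slice_range//= in_itv/= enorm_gt0 => /andP[z0 _].
    by case/negP: zD; rewrite inE.
  case: ifPn => // zr; rewrite /H /slice_density ifF ?mulr0//.
  apply/negbTE; rewrite negb_and -leNgt; apply/orP; left.
  rewrite leNgt; apply/negP => zc; case/negP: zr.
  by rewrite inE/= slice_range//= in_itv/= zc enorm_gt0 andbT; move: zD; rewrite inE.
rewrite (profile_change_of_variables _ _ prof)//; apply: eq_integral => u /[!inE] u0.
have e0 : 0 < enorm u by rewrite enorm_gt0.
rewrite /H -EFinM -mulrA (enorm_profile_map _ _ prof)// slice_density_jacobian//.
by congr (\1_B _ * _)%:E; rewrite /profile_map /slice_profile mulrAC mulfK ?gt_eqF.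
Qed.

(** Fix the last m coordinates w, change variables in the first n, then exchange
    the integrals and integrate over w. *)
Lemma ball_cone_marginal n m (c : R) (B : set 'rV[R]_n) :
  (0 < n)%N -> (0 < m)%N -> 0 < c -> measurable B ->
  (leb (n + m) (eball 0%R 1%R `&`
     [set x | B ((c / enorm x *: x) *m pid_mx n)%R]) =
   radial_moment n m * \int[leb n]_(z in [set z | (z != 0)%R])
     (\1_B z * fibre_mass c n m (enorm z))%:E)%E.
Proof.
move=> n0 m0 c0 mB.
set X := _ `&` _.
pose g (p : 'rV[R]_n * 'rV[R]_m) : \bar R :=
  (\1_B ((c / Num.sqrt (enorm p.1 ^+ 2 + enorm p.2 ^+ 2)) *: p.1)%R *
      (if (enorm p.1 ^+ 2 + enorm p.2 ^+ 2 < 1)%R then 1 else 0))%:E.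
have mcone : measurable_fun setT (fun x : 'rV[R]_(n + m) => (c / enorm x *: x) *m pid_mx n : 'rV[R]_n).
  apply/measurable_rVP => i.
  have -> : (fun x : 'rV[R]_(n + m) => ((c / enorm x *: x) *m pid_mx n : 'rV[R]_n) 0 i)
      = (fun x => c / enorm x * x 0 (lshift m i)).
    apply/funext => x; rewrite -scalemxAl mxE; congr (_ * _).
    by rewrite -[in LHS](hsubmxK x) pid_mx_col mul_row_col mulmx1 mulmx0 addr0 mxE.
  apply: measurable_funM; last exact: measurable_coord.
  by apply: measurable_funM => //; apply: measurable_funV; exact: measurable_enorm.
have mX : measurable X.
  apply: measurableI; first exact: measurable_eball.
  by rewrite -[X in measurable X]setTI; exact: mcone.
rewrite (measureE_integral _ _ _ (leb (n + m)))// integral_row_mx//; last first.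
  by apply/measurable_EFinP; exact: measurable_indic.
have indE u w : (\1_X (row_mx u w))%:E = g (u, w).
  have XE : X (row_mx u w) = ((enorm u ^+ 2 + enorm w ^+ 2 < 1) /\
      B ((c / Num.sqrt (enorm u ^+ 2 + enorm w ^+ 2)) *: u)).
    rewrite /X /eball/= cone_point_row_mx subr0 -sqr_enorm_row_mx.
    by rewrite expr_lt1 ?enorm_ge0.
  rewrite /g/= !indicE; case: ifPn => [q1|q1].
    rewrite mulr1; congr (_ %:R)%:E; apply: congr1.
    by apply/idP/idP; rewrite !inE XE; [case|split].
  by rewrite mulr0 memNset// XE => -[]; rewrite (negbTE q1).
under eq_integral do under eq_integral do rewrite indE.
have mg : measurable_fun setT g.
  have mq : measurable_fun setT (fun p : 'rV[R]_n * 'rV[R]_m =>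
      enorm p.1 ^+ 2 + enorm p.2 ^+ 2 : measurableTypeR R).
    apply: measurable_funD; apply: measurable_funX.
      exact: (measurableT_comp (@measurable_enorm R n)).
    exact: (measurableT_comp (@measurable_enorm R m)).
  apply/measurable_EFinP; apply: measurable_funM.
    apply: (measurableT_comp (f := \1_B : _ -> measurableTypeR R)) => //.
    apply: measurable_scale => //; apply: measurable_funM => //.
    apply: measurable_funV; apply: (measurableT_comp (f := @Num.sqrt R)) => //.
    by apply: continuous_measurable_fun; exact: sqrt_continuous.
  by apply: measurable_fun_ifT => //; exact: measurable_fun_ltr.
have g0 p : (0 <= g p)%E by rewrite lee_fin mulr_ge0//; case: ifP.
rewrite (fubini_tonelli g)//.
set D := [set z : 'rV[R]_n | z != 0].
have mD : measurable D := measurable_neq0 n.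
pose k (p : 'rV[R]_n * 'rV[R]_m) : \bar R :=
  (\1_(B `&` D) p.1 * slice_density c n (enorm p.2) (enorm p.1))%:E.
have mk : measurable_fun setT k.
  apply/measurable_EFinP; apply: measurable_funM.
    apply: (measurableT_comp (f := \1_(B `&` D) : _ -> measurableTypeR R)) => //.
    by apply: measurable_indic; exact: measurableI.
  apply: measurable_slice_density.
    exact: (measurableT_comp (@measurable_enorm R m)).
  exact: (measurableT_comp (@measurable_enorm R n)).
have k0 p : (0 <= k p)%E.
  by rewrite lee_fin mulr_ge0// slice_density_ge0 ?enorm_ge0// ltW.
transitivity (\int[leb m]_w \int[leb n]_z k (z, w))%E.
  rewrite [LHS]integral_neq0//; last 2 first.
  - by apply: (measurable_fun_fubini_tonelli_G g).
  - by move=> w; exact: integral_ge0.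
  rewrite [RHS]integral_neq0//; last 2 first.
  - by apply: (measurable_fun_fubini_tonelli_G k).
  - by move=> w; exact: integral_ge0.
  apply: eq_integral => w /[!inE] w0.
  have w_gt0 : 0 < enorm w by rewrite enorm_gt0.
  exact: (slice_integral n c B (enorm w) n0 c0 w_gt0 mB).
rewrite -(fubini_tonelli k)// [X in (_ * X)%E]integral_mkcond.
have mom0 : (0 <= radial_moment n m)%E.
  by apply: integral_ge0 => w _; rewrite lee_fin mulr_ge0 ?exprn_ge0 ?enorm_ge0//; case: ifP.
rewrite -ge0_integralZl//; last 2 first.
- apply/(measurable_restrictT _ mD); apply: measurable_funTS.
  apply/measurable_EFinP; apply: measurable_funM; first exact: measurable_indic.
  exact: (measurableT_comp (measurable_fibre_mass c n m) (@measurable_enorm R n)).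
- move=> z _; apply: erestrict_ge0 => {}z _.
  by rewrite lee_fin mulr_ge0// fibre_mass_ge0// ltW.
apply: eq_integral => z _.
rewrite patchE /k/= indicE in_setI.
under eq_integral do rewrite EFinM.
rewrite ge0_integralZl//; last 2 first.
- apply/measurable_EFinP; apply: measurable_slice_density => //.
  exact: measurable_enorm.
- by move=> w _; rewrite lee_fin slice_density_ge0 ?enorm_ge0// ltW.
rewrite integral_slice_density ?enorm_ge0// muleA -EFinM muleC indicE.
by case: (z \in D); rewrite ?andbT// andbF mul0r.
Qed.

End sphere_projection.

Section marginal.
Context {R : realType}.
Notation leb n := (@lebesgue_rV R n).

Definition ball_volume N : R := fine (leb N (eball (0 : 'rV[R]_N) 1)).

Lemma ball_volumeE N : leb N (eball (0 : 'rV[R]_N) 1) = (ball_volume N)%:E.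
Proof. by rewrite /ball_volume fineK// ge0_fin_numE ?eball1_lty ?measure_ge0. Qed.

Lemma ball_volume_gt0 N : 0 < ball_volume N.
Proof. by have := @eball1_gt0 R N; rewrite ball_volumeE lte_fin. Qed.

Definition marginal_const n N : R :=
  fine (radial_moment (R := R) n (N - n)) / ball_volume N.

Definition marginal_density n N (z : R) : R :=
  marginal_const n N * fibre_mass (Num.sqrt N%:R) n (N - n) z.

Lemma marginal_const_ge0 n N : 0 <= marginal_const n N.
Proof.
rewrite divr_ge0 ?(ltW (ball_volume_gt0 N))// fine_ge0//.
by apply: integral_ge0 => w _; rewrite lee_fin mulr_ge0 ?exprn_ge0 ?enorm_ge0//; case: ifP.
Qed.

Lemma marginal_density_ge0 n N z : 0 <= marginal_density n N z.
Proof. by rewrite mulr_ge0 ?marginal_const_ge0// fibre_mass_ge0// sqrtr_ge0. Qed.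

Lemma measurable_marginal_density n N :
  measurable_fun setT (marginal_density n N : measurableTypeR R -> measurableTypeR R).
Proof. by apply: measurable_funM => //; exact: measurable_fibre_mass. Qed.

Section with_profile.
Variables (rho s ds : R -> R).
Hypothesis prof : radial_profile R s ds.
Hypothesis rhoE : forall r, 0 < r -> s r = rho r * r.

Lemma radial_map_profile n (y : 'rV[R]_n) : y != 0 ->
  radial_map rho y = profile_map R s n y.
Proof.
move=> y0; have e0 : 0 < enorm y by rewrite enorm_gt0.
by rewrite /radial_map (negbTE y0) /profile_map rhoE// mulfK// gt_eqF.
Qed.

Lemma measurable_radial_map n : measurable_fun setT (@radial_map R rho n).
Proof.
have mD := @measurable_neq0 R n.
have -> : @radial_map R rho n = (fun y => if y != 0 then profile_map R s n y else 0).
  apply/funext => y; case: ifPn => [|/negPn/eqP ->]; first exact: radial_map_profile.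
  by rewrite /radial_map eqxx.
apply: measurable_fun_if => //.
- by apply: (measurable_fun_bool true); rewrite setTI.
- rewrite setTI; exact: measurable_profile_map prof _.
Qed.

Lemma measurable_cone_point n N : measurable_fun setT
  (fun x : 'rV[R]_N => radial_proj rho n ((Num.sqrt N%:R / enorm x) *: x)).
Proof.
apply: (measurableT_comp (@measurable_radial_map n)).
apply/measurable_rVP => i; under eq_fun do rewrite mxE.
apply: measurable_sum => j; apply: measurable_funM => //.
under eq_fun do rewrite mxE.
apply: measurable_funM; last exact: measurable_coord.
by apply: measurable_funM => //; apply: measurable_funV; exact: measurable_enorm.
Qed.

Lemma proj_measure_is_measure n N :
  exists P : {measure set 'rV[R]_n -> \bar R}, P = @proj_measure R rho n N :> (_ -> _).
Proof.
have k0 : 0 <= (ball_volume N)^-1 by rewrite invr_ge0 ltW// ball_volume_gt0.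
pose P0 := measure_function_pushforward__canonical__measure_function_Measure
  (mrestr (leb N) (measurable_eball N 0 1)) (measurable_cone_point n N).
exists (mscale (NngNum k0) P0); apply/funext => A.
transitivity ((ball_volume N)^-1%:E * leb N ((fun x : 'rV[R]_N =>
   radial_proj rho n ((Num.sqrt N%:R / enorm x) *: x)%R) @^-1` A `&` eball 0%R 1%R))%E.
  by [].
by rewrite muleC setIC.
Qed.

(** The projection followed by the radial map is the radial map applied to the
    marginal, which [ball_cone_marginal] gives for the preimage of A. *)
Lemma proj_measure_push_mass n N (A : set 'rV[R]_n) :
  (0 < n)%N -> (n < N)%N -> measurable A ->
  proj_measure rho N A = push_mass s n (marginal_density n N) A.
Proof.
move=> n0 nN mA.
have [m m0 NE] : exists2 m, (0 < m)%N & N = (n + m)%N.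
  by exists (N - n)%N; rewrite ?subn_gt0// subnKC// ltnW.
rewrite /marginal_density /marginal_const; subst N; rewrite addKn.
set c := Num.sqrt _.
have c0 : 0 < c by rewrite sqrtr_gt0 ltr0n addn_gt0 n0.
have mB : measurable (@radial_map R rho n @^-1` A).
  by rewrite -[X in measurable X]setTI; exact: measurable_radial_map.
have := ball_cone_marginal n m c _ n0 m0 c0 mB.
rewrite /proj_measure /pushforward /sphere_unif -/c.
rewrite -/(ball_volume _) => ->.
rewrite -[radial_moment n m]fineK ?radial_moment_fin// muleAC -EFinM.
set k := _ / _.
have k0 : 0 <= k.
  rewrite divr_ge0 ?(ltW (ball_volume_gt0 _))// fine_ge0//.
  by apply: integral_ge0 => w _; rewrite lee_fin mulr_ge0 ?exprn_ge0 ?enorm_ge0//; case: ifP.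
rewrite -ge0_integralZl//; last 3 first.
- exact: measurable_neq0.
- apply/measurable_EFinP; apply: measurable_funTS.
  apply: measurable_funM; first exact: measurable_indic.
  exact: (measurableT_comp (measurable_fibre_mass c n m) (@measurable_enorm R n)).
- by move=> z _; rewrite lee_fin mulr_ge0// fibre_mass_ge0// ltW.
rewrite /push_mass; apply: eq_integral => z /[!inE] z0.
rewrite -EFinM mulrCA; congr (_ * _)%:E; rewrite !indicE; congr (_ %:R).
by apply: congr1; apply/idP/idP; rewrite !inE/= radial_map_profile.
Qed.

Lemma proj_measureT n N : (0 < N)%N -> @proj_measure R rho n N setT = 1%E.
Proof.
move=> N0; rewrite /proj_measure /pushforward /sphere_unif preimage_setT.
rewrite (_ : [set _ | _] = setT) ?setIT; last exact/seteqP.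
rewrite -/(ball_volume N) (ball_volumeE N) -EFinM divff// gt_eqF//.
exact: ball_volume_gt0.
Qed.

End with_profile.
End marginal.

(** * Gaussian limit of the marginals *)

Section limit.
Context {R : realType}.
Notation leb n := (@lebesgue_rV R n).

(** The N-dependent factor of the marginal density: the power N - n - 2 of the
    cap height, written as a quotient so that it makes sense for all N. *)
Definition cap_profile n N (z : R) : R :=
  let b := cap_height (Num.sqrt N%:R) z in
  if z < Num.sqrt N%:R then b ^+ N / b ^+ n.+2 else 0.

Lemma fibre_mass_cap_profile n N z : (n <= N)%N ->
  fibre_mass (Num.sqrt N%:R) n (N - n) z = (Num.sqrt N%:R ^+ n)^-1 * cap_profile n N z.
Proof.
move=> nN; rewrite /fibre_mass /cap_profile; case: ifPn => _; last by rewrite mulr0.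
by rewrite subnKC// invfM mulrCA.
Qed.

Lemma cap_profile_ge0 n N z : 0 <= cap_profile n N z.
Proof.
rewrite /cap_profile; case: ifP => // _.
by apply: divr_ge0; apply: exprn_ge0; exact: sqrtr_ge0.
Qed.

Lemma cap_profile_gt0 n N z : 0 <= z < Num.sqrt N%:R -> 0 < cap_profile n N z.
Proof.
move=> /andP[z0 zN]; rewrite /cap_profile zN.
have c0 := le_lt_trans z0 zN.
have b0 : 0 < cap_height (Num.sqrt N%:R) z.
  rewrite /cap_height sqrtr_gt0 subr_gt0 expr_lt1 ?divr_ge0 ?(ltW c0)//.
  by rewrite ltr_pdivrMr// mul1r.
by apply: divr_gt0; apply: exprn_gt0.
Qed.

(** From 1 - x <= exp (- x). *)
Lemma cap_profile_le n N z : (n.+2 <= N)%N -> 0 <= z ->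
  cap_profile n N z <= expR (- ((N - n.+2)%:R / N%:R * (z ^+ 2 / 2))).
Proof.
move=> nN z0; rewrite /cap_profile; case: ifPn => [zN|_]; last exact: expR_ge0.
have N0 : 0 < N%:R :> R by rewrite ltr0n (leq_trans _ nN).
have c0 := le_lt_trans z0 zN.
set b := cap_height _ _.
have b0 : 0 < b.
  rewrite /b /cap_height sqrtr_gt0 subr_gt0 expr_lt1 ?divr_ge0 ?(ltW c0)//.
  by rewrite ltr_pdivrMr// mul1r.
have -> : b ^+ N / b ^+ n.+2 = b ^+ (N - n.+2).
  by rewrite -{1}(subnK nN) exprD mulfK// expf_neq0// gt_eqF.
have be : b <= expR (- (z ^+ 2 / N%:R / 2)).
  rewrite -[leRHS]ger0_norm ?expR_ge0// -sqrtr_sqr ler_wsqrtr//.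
  rewrite -expRM_natl expr_div_n sqr_sqrtr ?(ltW N0)//.
  rewrite (_ : 2 * - (z ^+ 2 / N%:R / 2) = - (z ^+ 2 / N%:R)); last by field; rewrite gt_eqF.
  exact: expR_ge1Dx.
apply: (@le_trans _ _ (expR (- (z ^+ 2 / N%:R / 2)) ^+ (N - n.+2))).
  by rewrite lerXn2r// nnegrE ?expR_ge0// ltW.
rewrite -expRM_natl ler_expR; rewrite (_ : _ * _ = - ((N - n.+2)%:R / N%:R * (z ^+ 2 / 2))) //.
by field; rewrite gt_eqF.
Qed.

(** From 1 - x >= exp (- x / (1 - x)), that is, 1 + y <= exp y for
    y = x / (1 - x). *)
Lemma cap_profile_ge n N z : (n.+2 <= N)%N -> 0 <= z < Num.sqrt N%:R ->
  expR (- (z ^+ 2 / 2 / (1 - z ^+ 2 / N%:R))) <= cap_profile n N z.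
Proof.
move=> nN /andP[z0 zN]; rewrite /cap_profile zN /=.
have N0 : 0 < N%:R :> R by rewrite ltr0n (leq_trans _ nN).
have c0 := le_lt_trans z0 zN.
set b := cap_height _ _.
have xlt : z ^+ 2 / N%:R < 1.
  rewrite ltr_pdivrMr// mul1r -[ltRHS]sqr_sqrtr ?(ltW N0)//.
  by rewrite ltr_sqr ?nnegrE// ltW.
have bE : b ^+ 2 = 1 - z ^+ 2 / N%:R.
  rewrite /b /cap_height expr_div_n (sqr_sqrtr (ltW N0)).
  by rewrite sqr_sqrtr// subr_ge0 ltW.
have b0 : 0 < b.
  rewrite /b /cap_height sqrtr_gt0 subr_gt0 expr_lt1 ?divr_ge0 ?(ltW c0)//.
  by rewrite ltr_pdivrMr// mul1r.
have b1 : b <= 1.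
  by rewrite /b /cap_height -[leRHS]sqrtr1 ler_wsqrtr// gerBl sqr_ge0.
have -> : b ^+ N / b ^+ n.+2 = b ^+ (N - n.+2).
  by rewrite -{1}(subnK nN) exprD mulfK// expf_neq0// gt_eqF.
apply: (@le_trans _ _ (b ^+ N)); last first.
  by rewrite ler_wiXn2l ?leq_subr// ltW.
have y0 : 0 < 1 - z ^+ 2 / N%:R by rewrite subr_gt0.
have y0' : N%:R - z ^+ 2 != 0.
  by rewrite subr_eq0 gt_eqF// -[ltRHS]mul1r -ltr_pdivrMr.
have be : expR (- (z ^+ 2 / N%:R / (1 - z ^+ 2 / N%:R) / 2)) <= b.
  rewrite -[leLHS]ger0_norm ?expR_ge0// -sqrtr_sqr -[leRHS]ger0_norm ?(ltW b0)// -[leRHS]sqrtr_sqr.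
  rewrite ler_wsqrtr// bE -expRM_natl.
  rewrite (_ : 2 * - _ = - (z ^+ 2 / N%:R / (1 - z ^+ 2 / N%:R))); last by field; rewrite y0' gt_eqF.
  rewrite expRN -[leRHS]invrK lef_pV2 ?posrE ?expR_gt0 ?invr_gt0//.
  apply: le_trans (expR_ge1Dx _).
  rewrite le_eqVlt; apply/orP; left; apply/eqP.
  by field; rewrite y0' gt_eqF.
apply: (@le_trans _ _ (expR (- (z ^+ 2 / N%:R / (1 - z ^+ 2 / N%:R) / 2)) ^+ N)); last first.
  by rewrite lerXn2r// nnegrE ?expR_ge0// ltW.
rewrite -expRM_natl ler_expR.
rewrite (_ : N%:R * _ = - (z ^+ 2 / 2 / (1 - z ^+ 2 / N%:R))) //.
by field; rewrite y0' gt_eqF.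
Qed.

Lemma cvg_invn : (N%:R^-1 : R) @[N --> \oo] --> (0 : R).
Proof.
apply/gtr0_cvgV0; last exact: cvgr_idn.
by near=> N; rewrite ltr0n; near: N; exact: nbhs_infty_gt.
Unshelve. all: by end_near. Qed.

Lemma cap_profile_cvg n z : 0 <= z ->
  cap_profile n N z @[N --> \oo] --> expR (- (z ^+ 2 / 2)).
Proof.
move=> z0.
apply: (@squeeze_cvgr nat \oo _ R
  (fun N => expR (- (z ^+ 2 / 2 / (1 - z ^+ 2 / N%:R))))
  (fun N => expR (- ((N - n.+2)%:R / N%:R * (z ^+ 2 / 2))))).
- near=> N; have nN : (n.+2 <= N)%N by near: N; exact: nbhs_infty_ge.
  rewrite cap_profile_le// andbT cap_profile_ge// z0/=.
  rewrite -[ltLHS]ger0_norm// -sqrtr_sqr ltr_sqrt; last by rewrite ltr0n (leq_trans _ nN).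
  by near: N; exact: nbhs_infty_gtr.
- apply: (cvg_comp _ expR); last exact: continuous_expR.
  apply: cvgN; rewrite -[X in _ --> X]mulr1; apply: cvgM; first exact: cvg_cst.
  rewrite -[X in _ --> X]invr1; apply: cvgV; first exact: oner_neq0.
  rewrite -[X in _ --> X]subr0; apply: cvgB; first exact: cvg_cst.
  rewrite -[X in _ --> X](mulr0 (z ^+ 2)); apply: cvgM; first exact: cvg_cst.
  exact: cvg_invn.
- apply: (cvg_comp _ expR); last exact: continuous_expR.
  apply: cvgN; rewrite -[X in _ --> X]mul1r; apply: cvgM; last exact: cvg_cst.
  have L : (1 - n.+2%:R * N%:R^-1 : R) @[N --> \oo] --> (1 : R).
    rewrite -[X in _ --> X]subr0; apply: cvgB; first exact: cvg_cst.
    rewrite -[X in _ --> X](mulr0 n.+2%:R); apply: cvgM; first exact: cvg_cst.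
    exact: cvg_invn.
  apply: cvg_trans L; apply: near_eq_cvg; near=> N.
  have nN : (n.+2 <= N)%N by near: N; exact: nbhs_infty_ge.
  rewrite natrB// mulrBl divff// pnatr_eq0 -lt0n.
  exact: leq_trans nN.
Unshelve. all: by end_near. Qed.

(** Once N >= 2 (n + 2), the exponent N - n - 2 is at least N / 2, which gives
    an integrable bound independent of N. *)
Lemma cap_profile_dom n N z : ((n.+2).*2 <= N)%N -> 0 <= z ->
  cap_profile n N z <= expR (- (z / 2) ^+ 2).
Proof.
move=> nN z0.
have nN' : (n.+2 <= N)%N by rewrite (leq_trans _ nN)// -addnn leq_addr.
have N0 : 0 < N%:R :> R by rewrite ltr0n (leq_trans _ nN').
apply: le_trans (cap_profile_le _ _ _ nN' z0) _.
rewrite ler_expR lerN2 (_ : (z / 2) ^+ 2 = 2^-1 * (z ^+ 2 / 2)); last by field.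
rewrite ler_wpM2r ?divr_ge0 ?sqr_ge0// ler_pdivlMr// mulrC ler_pdivrMr//.
by rewrite -natrM ler_nat mulnBl !muln2 -[N.*2]addnn -addnBA// leq_addr.
Qed.

Lemma measurable_cap_profile n N :
  measurable_fun setT (cap_profile n N : measurableTypeR R -> measurableTypeR R).
Proof.
have mb : measurable_fun setT (cap_height (Num.sqrt N%:R) : measurableTypeR R -> measurableTypeR R) :=
  measurable_cap_height _.
apply: measurable_fun_ifT => //; first exact: measurable_fun_ltr.
apply: measurable_funM; first exact: measurable_funX.
by apply: measurable_funV; exact: measurable_funX.
Qed.

(** Dominated convergence, with the bound of [cap_profile_dom]. *)
Lemma cap_profile_integral_cvg n (D : set 'rV[R]_n) (psi : 'rV[R]_n -> R) (M : R) :
  measurable D -> measurable_fun D psi -> (forall y, D y -> 0 <= psi y <= M) ->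
  (\int[leb n]_(y in D) (psi y * cap_profile n N (enorm y))%:E)%E @[N --> \oo] -->
  (\int[leb n]_(y in D) (psi y * expR (- (enorm y ^+ 2 / 2)))%:E)%E.
Proof.
move=> mD mpsi psiM.
(* The domination holds only from this rank on. *)
pose N0 := (n.+2).*2.
rewrite -(cvg_shiftn N0).
have mdens N : measurable_fun D (fun y : 'rV[R]_n => (psi y * cap_profile n N (enorm y))%:E).
  apply/measurable_EFinP; apply: measurable_funM => //; apply: measurable_funTS.
  exact: (measurableT_comp (measurable_cap_profile n N) (@measurable_enorm R n)).
have mexp : measurable_fun D (fun y : 'rV[R]_n => (psi y * expR (- (enorm y ^+ 2 / 2)))%:E).
  apply/measurable_EFinP; apply: measurable_funM => //; apply: measurable_funTS.
  apply: measurableT_comp => //; apply: measurableT_comp => //.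
  by apply: measurable_funM => //; apply: measurable_funX; exact: measurable_enorm.
pose g (y : 'rV[R]_n) : \bar R := (M * expR (- (enorm y / 2) ^+ 2))%:E.
have [|||_ _ +] := @dominated_convergence _ _ _ (leb n) D mD
  (fun N y => (psi y * cap_profile n (N + N0) (enorm y))%:E)
  (fun y => (psi y * expR (- (enorm y ^+ 2 / 2)))%:E) g (fun N => mdens (N + N0)%N) mexp.
- apply: aeW => y Dy; apply: cvg_EFin; first exact: nearW.
  apply: cvgM; first exact: cvg_cst.
  have := cap_profile_cvg n (enorm y) (enorm_ge0 _ y).
  by rewrite -(cvg_shiftn N0).
- have M0 : 0 <= `|M| by [].
  apply/integrableP; split.
    apply/measurable_EFinP; apply: measurable_funTS; apply: measurable_funM => //.
    by have /measurable_EFinP := @measurable_gaussian R n 2.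
  apply: (@le_lt_trans _ _ (\int[leb n]_y (`|M|%:E * (expR (- (enorm y / 2) ^+ 2))%:E))%E).
    apply: (@le_trans _ _ (\int[leb n]_(y in D) (`|M|%:E * (expR (- (enorm y / 2) ^+ 2))%:E))%E).
      rewrite le_eqVlt; apply/orP; left; apply/eqP; apply: eq_integral => y _.
      by rewrite /g /= normrM (ger0_norm (expR_ge0 _)) EFinM.
    apply: ge0_subset_integral => //.
      by apply: measurable_funeM; exact: measurable_gaussian.
  rewrite ge0_integralZl ?lee_fin//; last exact: measurable_gaussian.
  by rewrite integral_gaussian// -EFinM ltry.
- apply: aeW => y N Dy; rewrite /g gee0_abs lee_fin.
    have /andP[p0 pM] := psiM y Dy.
    apply: ler_pM => //; first exact: cap_profile_ge0.
    by apply: cap_profile_dom; rewrite ?leq_addl ?enorm_ge0.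
  by have /andP[p0 pM] := psiM y Dy; rewrite mulr_ge0// cap_profile_ge0.
exact.
Qed.

Lemma integral_standard_gaussian n :
  (\int[leb n]_y (expR (- (enorm y ^+ 2 / 2)))%:E = (((2 * pi) `^ (n%:R / 2)))%:E)%E.
Proof.
have sq2 : Num.sqrt 2 ^+ 2 = 2 :> R by rewrite sqr_sqrtr.
transitivity (\int[leb n]_y (expR (- (enorm y / Num.sqrt 2) ^+ 2))%:E)%E.
  by apply: eq_integral => y _; rewrite expr_div_n sq2.
rewrite integral_gaussian ?sqrtr_gt0//; congr EFin.
rewrite -sqrtrM// -powR12_sqrt ?mulr_ge0 ?pi_ge0//.
by rewrite -powR_mulrn ?powR_ge0// -powRrM [2^-1 * _]mulrC.
Qed.

End limit.

Section gaussian_limit.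
Context {R : realType}.
Notation leb n := (@lebesgue_rV R n).

Definition gaussian_profile n (z : R) : R :=
  (2 * pi) `^ (- (n%:R / 2)) * expR (- (z ^+ 2 / 2)).

Lemma gaussian_profile_gt0 n z : 0 < gaussian_profile n z.
Proof. by rewrite mulr_gt0 ?expR_gt0// powR_gt0// mulr_gt0// pi_gt0. Qed.

Lemma measurable_gaussian_profile n :
  measurable_fun setT (gaussian_profile n : measurableTypeR R -> measurableTypeR R).
Proof.
apply: measurable_funM => //; apply: measurableT_comp => //.
by apply: measurableT_comp => //; apply: measurable_funM.
Qed.

Lemma integral_gaussian_profile n : (\int[leb n]_y (gaussian_profile n (enorm y))%:E = 1)%E.
Proof.
have p0 : 0 < 2 * pi :> R by rewrite mulr_gt0// pi_gt0.
rewrite /gaussian_profile; under eq_integral do rewrite EFinM.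
rewrite ge0_integralZl//.
- rewrite integral_standard_gaussian -EFinM -powRD; last first.
    by apply/implyP => _; rewrite gt_eqF.
  by rewrite addNr powRr0.
- apply/measurable_EFinP; apply: measurableT_comp => //; apply: measurableT_comp => //.
  by apply: measurable_funM => //; apply: measurable_funX; exact: measurable_enorm.
- by rewrite lee_fin powR_ge0.
Qed.

Definition marginal_scale n N : R := marginal_const n N / Num.sqrt N%:R ^+ n.

Lemma marginal_scale_ge0 n N : 0 <= marginal_scale n N.
Proof. by rewrite divr_ge0 ?marginal_const_ge0// exprn_ge0// sqrtr_ge0. Qed.

(** The radial map for rho = 1; it gives access to the mass of the marginal
    itself. *)
Lemma identity_profile : radial_profile R (fun r => 1 * r) (fun=> 1).
Proof.
split.
- by move=> r; rewrite mul1r.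
- move=> r _; have -> : (fun r : R => 1 * r) = id by apply/funext => t; rewrite mul1r.
  exact: is_derive_id.
- by move=> r _; exact: cvg_cst.
- by move=> r1 r2 _; rewrite !mul1r.
Qed.

Variables (n : nat) (n_gt0 : (0 < n)%N).
Let D : set 'rV[R]_n := [set y | y != 0].
Let G : R := (2 * pi) `^ (n%:R / 2).

Let G_gt0 : 0 < G. Proof. by rewrite powR_gt0// mulr_gt0// pi_gt0. Qed.

Lemma marginal_densityE N (z : R) : (n < N)%N ->
  marginal_density n N z = marginal_scale n N * cap_profile n N z.
Proof.
move=> nN; rewrite /marginal_density fibre_mass_cap_profile 1?ltnW//.
by rewrite /marginal_scale mulrA.
Qed.

Lemma marginal_mass N : (n < N)%N ->
  ((marginal_scale n N)%:E * \int[leb n]_(y in D) (cap_profile n N (enorm y))%:E = 1)%E.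
Proof.
move=> nN; have := @proj_measureT R (fun=> 1) n N (leq_trans n_gt0 (ltnW nN)).
rewrite (proj_measure_push_mass _ _ _ identity_profile (fun _ _ => erefl))//.
rewrite -ge0_integralZl//.
- rewrite /push_mass => <-; apply: eq_integral => y /[!inE] y0.
  by rewrite -EFinM indicE mem_set// mul1r -marginal_densityE.
- exact: measurable_neq0.
- apply/measurable_EFinP; apply: measurable_funTS.
  exact: (measurableT_comp (measurable_cap_profile n N) (@measurable_enorm R n)).
- by move=> y _; rewrite lee_fin cap_profile_ge0.
- by rewrite lee_fin marginal_scale_ge0.
Qed.

(** The total mass of the marginal is 1 for every N, so the normalizing constant
    is the inverse of an integral whose limit is the Gaussian integral. No
    formula for the volume of balls is involved. *)
Lemma marginal_scale_cvg : marginal_scale n N @[N --> \oo] --> G^-1.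
Proof.
have mD : measurable D := measurable_neq0 n.
have ID : (\int[leb n]_(y in D) (1 * expR (- (enorm y ^+ 2 / 2)))%:E = G%:E)%E.
  under eq_integral do rewrite mul1r.
  rewrite -integral_neq0// ?integral_standard_gaussian//.
    apply/measurable_EFinP; apply: measurableT_comp => //; apply: measurableT_comp => //.
    by apply: measurable_funM => //; apply: measurable_funX; exact: measurable_enorm.
have := @cap_profile_integral_cvg R n D (fun=> 1) 1 mD (measurable_cst _)
  ltac:(by move=> y _; rewrite ler01 lexx).
rewrite ID => /fine_cvgP[Ifin Icvg].
apply: cvg_trans (cvgV (lt0r_neq0 G_gt0) Icvg).
apply: near_eq_cvg; near=> N.
have nN : (n < N)%N by near: N; exact: nbhs_infty_gt.
have fN : (\int[leb n]_(y in D) (1 * cap_profile n N (enorm y))%:E \is a fin_num)%E.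
  by near: N.
have := marginal_mass N nN.
under [X in (_ * X)%E]eq_integral do rewrite -[cap_profile _ _ _]mul1r.
rewrite -(fineK fN) -EFinM => -[] E /=.
have I0 : fine (\int[leb n]_(y in D) (1 * cap_profile n N (enorm y))%:E)%E != 0.
  by apply/eqP => I0; move/eqP: E; rewrite I0 mulr0 eq_sym oner_eq0.
by apply: (mulIf I0); rewrite E mulVf.
Unshelve. all: by end_near. Qed.

Lemma marginal_scale_gt0 N : (n < N)%N -> 0 < marginal_scale n N.
Proof.
move=> nN; rewrite lt_neqAle; apply/andP; split; last first.
  exact: marginal_scale_ge0.
apply/eqP => C0; have := marginal_mass N nN.
by rewrite -C0 mul0e => /eqP; rewrite eqe eq_sym oner_eq0.
Qed.

Lemma marginal_density_cvg (z : R) : 0 <= z ->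
  marginal_density n N z @[N --> \oo] --> gaussian_profile n z.
Proof.
move=> z0; rewrite /gaussian_profile powRN -/G.
apply: cvg_trans (cvgM marginal_scale_cvg (cap_profile_cvg n z z0)).
apply: near_eq_cvg; near=> N; rewrite marginal_densityE//.
by near: N; exact: nbhs_infty_gt.
Unshelve. all: by end_near. Qed.

Lemma marginal_density_gt0 N (z : R) : (n < N)%N -> 0 <= z < Num.sqrt N%:R -> 0 < marginal_density n N z.
Proof.
by move=> nN zN; rewrite marginal_densityE// mulr_gt0 ?marginal_scale_gt0// cap_profile_gt0.
Qed.

Lemma marginal_density_continuous N (z : R) : (n < N)%N -> 0 < z < Num.sqrt N%:R ->
  {for z, continuous (marginal_density n N)}.
Proof.
move=> nN /andP[z0 zN].
have c0 := lt_trans z0 zN.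
pose b (t : R) : R := cap_height (Num.sqrt N%:R) t.
have bz : b z != 0.
  rewrite gt_eqF// /b /cap_height sqrtr_gt0 subr_gt0 expr_lt1 ?divr_ge0 ?(ltW c0) ?(ltW z0)//.
  by rewrite ltr_pdivrMr// mul1r.
have cb : {for z, continuous b}.
  apply: (@continuous_comp _ _ _ (fun z : R => 1 - (z / Num.sqrt N%:R) ^+ 2) Num.sqrt);
    last exact: sqrt_continuous.
  apply: cvgB; first exact: cvg_cst.
  apply: (cvg_comp (fun z : R => z / Num.sqrt N%:R) (fun x => x ^+ 2)); last exact: exprn_continuous.
  by apply: cvgM; [exact: cvg_id|exact: cvg_cst].
have cX k : {for z, continuous (fun z => b z ^+ k)}.
  by apply: (cvg_comp b (fun x => x ^+ k)); [exact: cb|exact: exprn_continuous].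
have cc : {for z, continuous (fun z => marginal_scale n N * (b z ^+ N / b z ^+ n.+2))}.
  apply: cvgM; first exact: cvg_cst.
  apply: cvgM; first exact: cX.
  by apply: cvgV; [rewrite expf_neq0|exact: cX].
have E : marginal_density n N z = marginal_scale n N * (b z ^+ N / b z ^+ n.+2).
  by rewrite marginal_densityE// /cap_profile zN.
rewrite /prop_for /continuous_at E; apply: cvg_trans cc.
apply: near_eq_cvg; near=> t.
rewrite marginal_densityE// /cap_profile ifT//.
by near: t; exact: lt_nbhsl.
Unshelve. all: by end_near. Qed.

End gaussian_limit.

(** * Images of the sphere and of the space *)

Section radial_image.
Context {R : realType}.
Notation leb n := (@lebesgue_rV R n).

Lemma measurable_continuous_rV n (phi : 'rV[R]_n -> R) :
  continuous phi -> measurable_fun setT (phi : _ -> measurableTypeR R).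
Proof.
move=> cphi.
apply: (measurability _ (RGenOInfty.measurableE R)) => _ [_ [a ->] <-].
rewrite setTI; apply: sub_sigma_algebra.
by apply: open_comp => // x _; exact: cphi.
Qed.

Lemma probability_exists d (T : measurableType d)
    (nu : {measure set T -> \bar R}) : nu setT = 1%E ->
  exists P : probability T R, P = nu :> (set T -> \bar R).
Proof.
move=> nu1; pose P A := nu A.
pose M := isMeasure.Build _ _ _ P (measure0 nu) (measure_ge0 nu)
  (@measure_semi_sigma_additive _ _ _ nu).
pose mM : {measure set T -> \bar R} := HB.pack P M.
pose S := Measure_isProbability.Build _ _ _ mM nu1.
by exists (HB.pack P M S : probability T R).
Qed.

Section with_profile.
Variables (rho s ds : R -> R).
Hypothesis prof : radial_profile R s ds.
Hypothesis rhoE : forall r, 0 < r -> s r = rho r * r.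

(** Every point at distance s r from the origin is the image of the point of the
    same ray at distance r. *)
Lemma profile_map_ray n (x : 'rV[R]_n) r : x != 0 -> 0 < r -> enorm x = s r ->
  exists y : 'rV[R]_n, [/\ y != 0, enorm y = r & profile_map R s n y = x].
Proof.
move=> x0 r0 xr; have e0 : 0 < enorm x by rewrite enorm_gt0.
have ey : enorm ((r / enorm x) *: x) = r.
  by rewrite enormZ gtr0_norm ?divr_gt0// divfK// gt_eqF.
exists ((r / enorm x) *: x); split=> //.
  by rewrite -enorm_gt0 ey.
rewrite /profile_map ey scalerA -xr mulrA divfK ?gt_eqF//.
by rewrite divff ?scale1r// gt_eqF.
Qed.

Lemma radial_image n (x : 'rV[R]_n) :
  (@radial_map R rho n @` [set y | y != 0]) x <-> profile_range R s (enorm x).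
Proof.
have [s0 _ _ _] := prof.
split=> [[y /= y0 <-]|[r /= r0 xr]].
  rewrite (radial_map_profile _ _ rhoE)// (enorm_profile_map _ _ prof)//.
  by exists (enorm y) => //=; rewrite enorm_gt0.
have x0 : x != 0 by rewrite -enorm_gt0 -xr s0.
have [y [y0 _ yx]] := profile_map_ray _ _ _ x0 r0 (esym xr).
by exists y => //=; rewrite (radial_map_profile _ _ rhoE).
Qed.

(** The first block of a point of the sphere has norm at most sqrt N, and each
    such norm occurs: complete y by a multiple of a unit vector in one of the
    remaining coordinates, of which there is at least one because n < N. *)
Lemma sphere_image n N (x : 'rV[R]_n) : (n < N)%N -> x != 0 ->
  (@radial_proj R rho n N @` @sphere R N) x <->
  exists r, [/\ 0 < r, r <= Num.sqrt N%:R & enorm x = s r].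
Proof.
move=> nN x0.
have [m m0 NE] : exists2 m, (0 < m)%N & N = (n + m)%N.
  by exists (N - n)%N; rewrite ?subn_gt0// subnKC// ltnW.
subst N; split=> [[z zS zx]|[r [r0 rN xr]]].
  pose u := lsubmx z; pose w := rsubmx z.
  have zE : z = row_mx u w by rewrite hsubmxK.
  have pz : z *m pid_mx n = u.
    by rewrite zE pid_mx_col mul_row_col mulmx1 mulmx0 addr0.
  move: zx; rewrite /radial_proj pz => ux.
  have u0 : u != 0.
    by apply: contraNneq x0 => u0; rewrite -ux u0 /radial_map eqxx.
  exists (enorm u); split.
  - by rewrite enorm_gt0.
  - rewrite -zS -ler_sqr ?nnegrE ?enorm_ge0// zE sqr_enorm_row_mx.
    by rewrite lerDl sqr_ge0.
  - by rewrite -ux (radial_map_profile _ _ rhoE)// (enorm_profile_map _ _ prof).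
have [y [y0 yr yx]] := profile_map_ray _ _ _ x0 r0 xr.
pose q := Num.sqrt ((n + m)%:R - r ^+ 2).
pose w : 'rV[R]_m := q *: delta_mx 0 (Ordinal m0).
have q2 : q ^+ 2 = (n + m)%:R - r ^+ 2.
  rewrite sqr_sqrtr// subr_ge0 -[leRHS]sqr_sqrtr ?ler0n//.
  by rewrite ler_sqr ?nnegrE ?sqrtr_ge0// ltW.
have w2 : enorm w ^+ 2 = q ^+ 2.
  rewrite sqr_enorm (bigD1 (Ordinal m0))//= !mxE !eqxx mulr1.
  rewrite big1 ?addr0// => j /negbTE jm; rewrite !mxE jm andbF mulr0 expr0n//.
exists (row_mx y w).
  rewrite /sphere/= -[LHS]ger0_norm ?enorm_ge0// -sqrtr_sqr sqr_enorm_row_mx.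
  by rewrite w2 q2 yr subrKC.
rewrite /radial_proj pid_mx_col mul_row_col mulmx1 mulmx0 addr0.
by rewrite (radial_map_profile _ _ rhoE).
Qed.

(** P is the image of the measure with density f(|y|), so an integral against P
    is that of the composite with the radial map. *)
Lemma integral_push_mass n (f : R -> R) (P : {measure set 'rV[R]_n -> \bar R})
    (psi : 'rV[R]_n -> R) :
  (forall r, 0 <= f r) ->
  measurable_fun setT (f : measurableTypeR R -> measurableTypeR R) ->
  (forall A, measurable A -> P A = push_mass s n f A) ->
  measurable_fun setT psi -> (forall x, 0 <= psi x) ->
  (\int[P]_x (psi x)%:E = \int[leb n]_(y in [set y | (y != 0)%R])
     (psi (profile_map R s n y) * f (enorm y))%:E)%E.
Proof.
move=> f0 mf PE mpsi psi0.
set D := [set y : 'rV[R]_n | y != 0].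
have mD : measurable D := measurable_neq0 n.
have mfe : measurable_fun setT (fun y : 'rV[R]_n => f (enorm y) : measurableTypeR R).
  exact: (measurableT_comp mf (@measurable_enorm R n)).
have mpm := measurable_profile_map _ _ prof n.
have [dn dnE] := @density_measure_exists _ _ _ (leb n) (fun y => (f (enorm y))%:E)
  ltac:(exact/measurable_EFinP) ltac:(by move=> y; rewrite lee_fin).
have [nu [nuE nuint]] := @image_measure_exists _ _ _ _ _ dn D _ mD mpm.
have PD (A : set 'rV[R]_n) g : (\int[leb n]_(y in D `&` profile_map R s n @^-1` A) (g y)%:E
    = \int[leb n]_(y in D) (\1_A (profile_map R s n y) * g y)%:E)%E.
  rewrite integral_mkcondr; apply: eq_integral => y yD.
  rewrite patchE indicE.
  have -> : (y \in profile_map R s n @^-1` A) = (profile_map R s n y \in A).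
    by apply/idP/idP; rewrite !inE.
  by case: ifP => _; rewrite ?mul1r// mul0r.
transitivity (\int[nu]_x (psi x)%:E)%E.
  apply: eq_measure_integral => A mA _.
  by rewrite PE// nuE// dnE PD.
rewrite nuint//; last exact/measurable_EFinP.
rewrite [LHS]integral_mkcond (@integral_density _ _ _ (leb n) dn (fun y => f (enorm y)))//.
- rewrite [RHS]integral_mkcond; apply: eq_integral => y _.
  by rewrite !patchE; case: ifP => _; rewrite ?mul0e// -EFinM.
- apply/(measurable_restrictT _ mD)/measurable_EFinP.
  by apply: (@measurable_comp _ _ _ _ _ _ setT psi).
- by move=> y; apply: erestrict_ge0 => z _; rewrite lee_fin.
- by move=> A mA; rewrite dnE.
Qed.

End with_profile.
End radial_image.

(** * The limit law *)

(** Reduces the integral of a bounded function to that of a nonnegative one. *)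
Lemma integral_shift d (T : measurableType d) (R : realType) (P : {measure set T -> \bar R})
    (phi : T -> R) (M : R) : P setT = 1%E ->
  measurable_fun setT phi -> (forall x, `|phi x| <= M) ->
  (\int[P]_x (phi x)%:E = \int[P]_x (phi x + M)%:E - M%:E)%E.
Proof.
move=> P1 mphi phiM.
have Pfin : (P setT < +oo)%E by rewrite P1 ltry.
have iphi : P.-integrable setT (EFin \o phi).
  apply: measurable_bounded_integrable => //.
  exists M; split; first exact: num_real.
  by move=> K MK x _; exact: le_trans (phiM x) (ltW MK).
have iM : P.-integrable setT (EFin \o cst M).
  apply: measurable_bounded_integrable => //.
  exists `|M|; split; first exact: num_real.
  by move=> K MK x _; exact: ltW.
under [in RHS]eq_integral do rewrite EFinD.
rewrite (integralD_EFin _ iphi iM)//= integral_cst// P1 mule1.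
by rewrite addeK.
Qed.

Section radial_law.
Context {R : realType}.
Notation leb n := (@lebesgue_rV R n).
Notation mu := (@lebesgue_measure R).
Variables (rho sigma : R -> R).
Hypothesis rho_gt0 : forall t, 0 < t -> 0 < rho t.
Hypothesis rho_C1 : forall t : R, 0 < t ->
    derivable rho t 1 /\ {for t, continuous rho^`()%classic}.
Hypothesis rho_incr : {homo radial_map1 rho : s t / s < t}.
Hypothesis sigmaK : cancel (radial_map1 rho) sigma.

Let s (r : R) := rho r * r.
Let ds (r : R) := rho^`()%classic r * r + rho r.

Lemma radial_map1_pos r : 0 < r -> radial_map1 rho r = s r.
Proof. by move=> r0; rewrite /radial_map1 gt_eqF// gtr0_norm. Qed.

(** The data of the theorem fit the setting of radial profiles, with
    s r = rho r * r. *)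
Lemma rho_profile : radial_profile R s ds.
Proof.
have drho (r : R) : 0 < r -> is_derive r (1 : R) rho (rho^`()%classic r).
  by move=> r0; have [d _] := rho_C1 _ r0; rewrite derive1E; apply: DeriveDef.
split.
- by move=> r r0; rewrite mulr_gt0// rho_gt0.
- move=> r r0.
  have := is_deriveM (drho r r0) (is_derive_id r (1 : R)) => h.
  apply: (is_derive_eq (h : is_derive r 1 s _)).
  by rewrite /ds /GRing.scale/= mulr1 addrC mulrC.
- move=> r r0; have [d c] := rho_C1 _ r0.
  apply: cvgD; first by apply: cvgM => //; exact: cvg_id.
  by apply: differentiable_continuous; apply/derivable1_diffP.
- move=> r1 r2 r10 r12.
  by rewrite -!radial_map1_pos ?rho_incr// (lt_trans r10).
Qed.

Let prof := rho_profile.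

Let rhoE r : 0 < r -> s r = rho r * r. Proof. by []. Qed.

Lemma sigma_profileK r : 0 < r -> sigma (s r) = r.
Proof. by move=> r0; rewrite -radial_map1_pos// sigmaK. Qed.

Lemma derive1_radial_map1 r : 0 < r -> (radial_map1 rho)^`()%classic r = ds r.
Proof.
move=> r0; rewrite derive1E.
have [_ dS _ _] := prof.
apply: (@derive_val _ _ _ _ _ _ _ _).
apply: (near_eq_is_derive (f := s)); last exact: dS.
near=> t; rewrite radial_map1_pos//; near: t; exact: lt_nbhsr.
Unshelve. all: by end_near. Qed.

Variables (n : nat) (n_gt0 : (0 < n)%N).

Let D : set 'rV[R]_n := [set y | y != 0].

Lemma proj_ball_ratio_cvg N x r : (n < N)%N -> 0 < r < Num.sqrt N%:R ->
  enorm x = s r ->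
  @proj_ball_ratio R rho n N x e @[e --> 0^'+] -->
    if ds r == 0 then +oo%E else (marginal_density n N r / profile_jacobian R s ds n r)%:E.
Proof.
move=> nN rN xr; have /andP[r0 rlt] := rN.
have -> : @proj_ball_ratio R rho n N x = (fun e => push_mass s n (marginal_density n N) (eball x e) *
    ((e ^+ n * fine (leb n (eball (0 : 'rV[R]_n) 1)))^-1)%:E)%E.
  apply/funext => e; rewrite /proj_ball_ratio (proj_measure_push_mass _ _ _ prof rhoE)//.
  exact: measurable_eball.
apply: (ball_ratio_cvg _ _ _ prof sigma_profileK) => //.
- by move=> t _; exact: marginal_density_ge0.
- exact: measurable_marginal_density.
- exact: marginal_density_continuous.
- by apply: marginal_density_gt0; rewrite ?ltW.
Qed.

(** The limit density is the density of the image of the standard Gaussian: the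
    factor (sigma / |x|)^(n - 1) sigma' is the inverse of the Jacobian. *)
Lemma limit_density_push : @limit_density R rho sigma n =
  push_density s ds sigma n (gaussian_profile n).
Proof.
apply/funext => x; rewrite /limit_density /push_density.
have -> : (x \in @radial_map R rho n @` [set y | y != 0]) =
    (enorm x \in profile_range R s).
  by apply/idP/idP; rewrite !inE => /(radial_image _ _ _ prof rhoE).
case: ifPn => // /[!inE] -[r /= r0 <-].
rewrite sigma_profileK// (ederive1_profile_inverse _ _ _ prof sigma_profileK)//.
have s0 : 0 < s r by rewrite mulr_gt0// rho_gt0.
have q0 : 0 < (r / s r) ^+ n.-1 by rewrite exprn_gt0// divr_gt0.
case: ifPn => d0.
  rewrite gt0_muley// lte_fin mulr_gt0//.
  exact: gaussian_profile_gt0.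
rewrite -EFinM; congr EFin.
rewrite /profile_jacobian [(ds r * _)^-1]invfM -exprVn [(s r / r)^-1]invf_div.
by rewrite -/(gaussian_profile n r) -mulrA; congr (_ * _); rewrite mulrC.
Qed.

(** For N large, |x| = s r with r < sqrt N, so that the ball ratios converge to
    the transported marginal density at r; then let N grow. If |x| is not in
    the range of s, all the values are 0. *)
Lemma proj_density_cvg (x : 'rV[R]_n) : x != 0 ->
  (\forall N \near \oo, (@radial_proj R rho n N @` @sphere R N) x ->
     cvg (proj_ball_ratio rho N x e @[e --> 0^'+])) /\
  proj_density rho N x @[N --> \oo] --> limit_density rho sigma x.
Proof.
move=> x0.
have [/= xr|xr] := pselect (profile_range R s (enorm x)); last first.
  have notim N : (n < N)%N -> ~ (@radial_proj R rho n N @` @sphere R N) x.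
    move=> nN /(sphere_image _ _ _ prof rhoE _ _ _ nN x0)[r [r0 _ xE]].
    by apply: xr; exists r.
  split.
    near=> N; have nN : (n < N)%N by near: N; exact: nbhs_infty_gt.
    by move=> /(notim _ nN).
  have -> : limit_density rho sigma x = 0%E.
    by rewrite limit_density_push /push_density ifF//; apply/negbTE; rewrite notin_setE.
  apply: cvg_near_cst; near=> N.
  have nN : (n < N)%N by near: N; exact: nbhs_infty_gt.
  rewrite /proj_density ifF//; apply/negbTE; rewrite notin_setE => -[].
  by move=> /(notim _ nN).
have [r r0 xE] := xr.
have big : \forall N \near \oo, (n < N)%N /\ r < Num.sqrt N%:R.
  near=> N; split; first by near: N; exact: nbhs_infty_gt.
  rewrite -[ltLHS](gtr0_norm r0) -sqrtr_sqr ltr_sqrt; last first.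
    by rewrite ltr0n; near: N; exact: nbhs_infty_gt.
  by near: N; exact: nbhs_infty_gtr.
have rc N : (n < N)%N /\ r < Num.sqrt N%:R -> @proj_ball_ratio R rho n N x e @[e --> 0^'+] -->
    if ds r == 0 then +oo%E else (marginal_density n N r / profile_jacobian R s ds n r)%:E.
  by move=> [nN rN]; apply: proj_ball_ratio_cvg => //; rewrite r0.
split.
  by apply: filterS big => N nN _; apply/cvg_ex; eexists; exact: rc nN.
have pdE : \forall N \near \oo, (if ds r == 0 then +oo%E
    else (marginal_density n N r / profile_jacobian R s ds n r)%:E) = proj_density rho N x.
  apply: filterS big => N [nN rN]; apply/esym.
  rewrite /proj_density ifT.
    by apply/cvg_lim; [exact: ereal_hausdorff|exact: rc].
  rewrite inE; split; last by apply/eqP.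
  by apply/(sphere_image _ _ _ prof rhoE _ _ _ nN x0); exists r; split=> //; exact: ltW.
rewrite limit_density_push /push_density -xE mem_set; last by exists r.
rewrite sigma_profileK//.
apply: cvg_trans (near_eq_cvg pdE) _.
case: ifPn => d0; first exact: cvg_cst.
apply: cvg_EFin; first exact: nearW.
by apply: cvgM; [by apply: (marginal_density_cvg _ n_gt0); exact: ltW|exact: cvg_cst].
Unshelve. all: by end_near. Qed.

(** The spheres of radius s (sqrt N) are left aside because the marginal density
    may jump at sqrt N. *)
Lemma proj_density_push N (x : 'rV[R]_n) : (n < N)%N -> x != 0 ->
  enorm x != s (Num.sqrt N%:R) ->
  push_density s ds sigma n (marginal_density n N) x \is a fin_num ->
  @proj_density R rho n N x = push_density s ds sigma n (marginal_density n N) x.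
Proof.
move=> nN x0 xN; rewrite /push_density.
have [/= xr|xr] := pselect (profile_range R s (enorm x)); last first.
  rewrite ifF; last by apply/negbTE; rewrite notin_setE.
  move=> _; rewrite /proj_density ifF//; apply/negbTE; rewrite notin_setE => -[].
  move=> /(sphere_image _ _ _ prof rhoE _ _ _ nN x0)[r [r0 _ xE]] _.
  by apply: xr; exists r.
have [r /= r0 xE] := xr.
rewrite mem_set// -xE sigma_profileK//.
have [rN|rN] := ltP r (Num.sqrt N%:R).
  move=> _; rewrite /proj_density ifT; last first.
    rewrite inE; split; last exact/eqP.
    apply/(sphere_image _ _ _ prof rhoE _ _ _ nN x0).
    by exists r; split => //; exact: ltW.
  apply/cvg_lim; first exact: ereal_hausdorff.
  by apply: proj_ball_ratio_cvg => //; rewrite r0.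
case: ifPn => // d0 _.
rewrite /marginal_density /fibre_mass ltNge rN /= mulr0 mul0r.
rewrite /proj_density ifF//; apply/negbTE; rewrite notin_setE => -[].
move=> /(sphere_image _ _ _ prof rhoE _ _ _ nN x0)[r' [r'0 r'N xE']] _.
have rr' : r = r' by rewrite -(sigma_profileK _ r0) xE xE' sigma_profileK.
move: xN; rewrite -xE (_ : r = Num.sqrt N%:R) ?eqxx//.
by apply/eqP; rewrite eq_le rN rr' r'N.
Qed.

Hypothesis crit0 :
  mu [set t | 0 < t /\ (radial_map1 rho)^`()%classic t = 0] = 0%E.

Let crit_null : mu [set t | 0 < t /\ ds t = 0] = 0%E.
Proof.
rewrite -[RHS]crit0; congr (mu _).
by apply/seteqP; split=> t [t0 dt]; split=> //; move: dt; rewrite derive1_radial_map1.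
Qed.

Lemma proj_measure_density N A : (n < N)%N -> measurable A ->
  @proj_measure R rho n N A = (\int[leb n]_(x in A) push_density s ds sigma n (marginal_density n N) x)%E.
Proof.
move=> nN mA; rewrite (integral_push_density _ _ _ prof sigma_profileK)//.
- exact: (proj_measure_push_mass _ _ _ prof rhoE).
- by move=> r _; exact: marginal_density_ge0.
- exact: measurable_marginal_density.
Qed.

(** The transported marginal density has total mass 1, hence is finite almost
    everywhere, and the two functions can differ only at the origin, on the
    sphere of radius s (sqrt N), or where that density is infinite. *)
Lemma proj_is_density N : (n < N)%N ->
  is_density (@proj_measure R rho n N) (@proj_density R rho n N).
Proof.
move=> nN.
have g0 : forall x, (0 <= push_density s ds sigma n (marginal_density n N) x)%E.
  by move=> x; apply: (push_density_ge0 _ _ _ prof sigma_profileK) => r _; exact: marginal_density_ge0.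
have mg : measurable_fun setT (push_density s ds sigma n (marginal_density n N)).
  by apply: (measurable_push_density _ _ _ prof sigma_profileK); exact: measurable_marginal_density.
exists (push_density s ds sigma n (marginal_density n N)); split => //; last first.
  by move=> A mA; exact: proj_measure_density.
have ig : (leb n).-integrable setT (push_density s ds sigma n (marginal_density n N)).
  apply/integrableP; split=> //.
  under eq_integral do rewrite gee0_abs//.
  by rewrite -proj_measure_density// proj_measureT ?ltry// (leq_trans n_gt0 (ltnW nN)).
have fin := integrable_ae (@measurableT _ _) ig.
have ne0 : {ae leb n, forall x, x != 0}.
  exists [set 0]; split; [exact: measurable_origin|exact: lebesgue_rV_origin|].
  by move=> x /= /negP/negPn/eqP.
have neN : {ae leb n, forall x, ~ (x != 0 /\ [set s (Num.sqrt N%:R)] (enorm x))}.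
  exists [set x | x != 0 /\ [set s (Num.sqrt N%:R)] (enorm x)]; split.
  - apply: (@measurableI _ _ [set x : 'rV[R]_n | x != 0]); first exact: measurable_neq0.
    by rewrite -[X in measurable X]setTI; apply: (@measurable_enorm R n).
  - by apply: lebesgue_rV_radial_null => //; rewrite lebesgue_measure_set1.
  - by move=> x /= /contrapT.
apply: filterS3 fin ne0 neN => x finx x0 xN _.
apply: proj_density_push => //; last exact: finx.
by apply/eqP => xs; apply: xN; split.
Qed.

Lemma measurable_limit_density : measurable_fun setT (@limit_density R rho sigma n).
Proof.
rewrite limit_density_push.
by apply: (measurable_push_density _ _ _ prof sigma_profileK); exact: measurable_gaussian_profile.
Qed.

Lemma limit_density_ge0 x : (0 <= @limit_density R rho sigma n x)%E.
Proof.
rewrite limit_density_push.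
by apply: (push_density_ge0 _ _ _ prof sigma_profileK) => r _; rewrite ltW// gaussian_profile_gt0.
Qed.

Lemma integral_limit_density A : measurable A ->
  (\int[leb n]_(x in A) limit_density rho sigma x = push_mass s n (gaussian_profile n) A)%E.
Proof.
move=> mA; rewrite limit_density_push.
apply: (integral_push_density _ _ _ prof sigma_profileK) => //.
- by move=> r _; rewrite ltW// gaussian_profile_gt0.
- exact: measurable_gaussian_profile.
Qed.

Lemma integral_limit_densityT : (\int[leb n]_x limit_density rho sigma x = 1)%E.
Proof.
rewrite integral_limit_density// /push_mass.
under eq_integral do rewrite indicT mul1r.
rewrite -integral_neq0//; first exact: integral_gaussian_profile.
- apply/measurable_EFinP.
  exact: (measurableT_comp (measurable_gaussian_profile n) (@measurable_enorm R n)).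
- by move=> y; rewrite lee_fin ltW// gaussian_profile_gt0.
Qed.

(** Transported back along the radial map, the integrals of a test function
    against the push-forwards are integrals against the marginals, up to their
    normalizing constants, and [cap_profile_integral_cvg] applies. *)
Lemma proj_measure_weak_cvg (nu : {measure set 'rV[R]_n -> \bar R}) :
  nu setT = 1%E ->
  (forall A, measurable A -> nu A = (\int[leb n]_(x in A) limit_density rho sigma x)%E) ->
  weakly_converges (fun N => @proj_measure R rho n N) nu.
Proof.
move=> nu1 nuE phi cphi [M phiM].
have mphi := measurable_continuous_rV n phi cphi.
(* The integration lemmas are stated for nonnegative functions. *)
pose psi x := phi x + M.
have psi0 x : 0 <= psi x by rewrite -lerBlDr sub0r; have := phiM x; rewrite ler_norml => /andP[].
have psiM x : psi x <= M + M by rewrite lerD2r; exact: le_trans (ler_norm _) (phiM x).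
have mpsi : measurable_fun setT (psi : _ -> measurableTypeR R) by exact: measurable_funD.
have mpm := measurable_profile_map _ _ prof n.
pose psi' y := psi (profile_map R s n y).
have mD : measurable D := measurable_neq0 n.
have mpsi' : measurable_fun D psi'.
  by apply: (@measurable_comp _ _ _ _ _ _ setT psi).
have shiftE (P : {measure set 'rV[R]_n -> \bar R}) : P setT = 1%E ->
    (\int[P]_x (phi x)%:E = \int[P]_x (psi x)%:E - M%:E)%E.
  by move=> P1; exact: integral_shift.
rewrite shiftE//.
have capcvg := @cap_profile_integral_cvg R n D psi' (M + M) mD mpsi'
  ltac:(by move=> y _; rewrite psi0 psiM).
have nuint : (\int[nu]_x (psi x)%:E = ((2 * pi) `^ (n%:R / 2))^-1%:E *
    \int[leb n]_(y in D) (psi' y * expR (- (enorm y ^+ 2 / 2)))%:E)%E.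
  rewrite (integral_push_mass _ _ prof n (gaussian_profile n) nu psi)//.
  - rewrite -ge0_integralZl//.
    + apply: eq_integral => y _; rewrite -EFinM /gaussian_profile powRN.
      by rewrite /psi' mulrCA.
    + apply/measurable_EFinP; apply: measurable_funM => //.
      apply: measurable_funTS; apply: measurableT_comp => //; apply: measurableT_comp => //.
      by apply: measurable_funM => //; apply: measurable_funX; exact: measurable_enorm.
    + by move=> y _; rewrite lee_fin mulr_ge0 ?psi0// expR_ge0.
    + by rewrite lee_fin invr_ge0 powR_ge0.
  - by move=> r; rewrite ltW// gaussian_profile_gt0.
  - exact: measurable_gaussian_profile.
  - by move=> A mA; rewrite nuE// integral_limit_density.
have Ccvg : (marginal_scale n N : R)%:E @[N --> \oo] --> (((2 * pi) `^ (n%:R / 2))^-1)%:E.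
  by apply/fine_cvgP; split; [exact: nearW|exact: marginal_scale_cvg].
(* The product of limits makes sense since the scalar is nonzero. *)
have cdef : ((((2 * pi) `^ (n%:R / 2))^-1)%:E *?
    \int[leb n]_(y in D) (psi' y * expR (- (enorm y ^+ 2 / 2)))%:E)%E.
  have G0 : ((((2 * pi) `^ (n%:R / 2))^-1)%:E != 0 :> \bar R)%E.
    by rewrite eqe invr_neq0// gt_eqF// powR_gt0// mulr_gt0// pi_gt0.
  by case: (boolP (\int[leb n]_(y in D) (psi' y * expR (- (enorm y ^+ 2 / 2)))%:E \is a fin_num)%E) => If;
    [exact: mule_def_fin|exact: mule_def_neq0_infty].
rewrite nuint.
have cv := cvgeM cdef Ccvg capcvg.
suff lim : \forall N \near \oo, (\int[@proj_measure R rho n N]_x (phi x)%:E)%E =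
    ((marginal_scale n N)%:E * \int[leb n]_(y in D) (psi' y * cap_profile n N (enorm y))%:E - M%:E)%E.
  apply: cvg_trans (near_eq_cvg (filterS (fun N => @esym _ _ _) lim)) _.
  apply: cvgeB; [by rewrite fin_num_adde_defl|exact: cv|exact: cvg_cst].
near=> N.
have nN : (n < N)%N by near: N; exact: nbhs_infty_gt.
have [P PE] := proj_measure_is_measure _ _ _ prof rhoE n N.
rewrite -PE shiftE; last first.
  by rewrite PE proj_measureT// (leq_trans n_gt0 (ltnW nN)).
congr (_ - _)%E.
rewrite (integral_push_mass _ _ prof n (marginal_density n N) P psi)//.
- rewrite -ge0_integralZl//.
  + by apply: eq_integral => y _; rewrite -EFinM marginal_densityE// mulrCA.
  + apply/measurable_EFinP; apply: measurable_funM => //.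
    apply: measurable_funTS.
    exact: (measurableT_comp (measurable_cap_profile n N) (@measurable_enorm R n)).
  + by move=> y _; rewrite lee_fin mulr_ge0 ?psi0// cap_profile_ge0.
  + by rewrite lee_fin marginal_scale_ge0.
- by move=> r; exact: marginal_density_ge0.
- exact: measurable_marginal_density.
- by move=> A mA; rewrite PE (proj_measure_push_mass _ _ _ prof rhoE).
Unshelve. all: by end_near. Qed.

Lemma limit_law : exists nu : probability 'rV[R]_n R,
  (forall A, measurable A -> nu A = (\int[leb n]_(x in A) limit_density rho sigma x)%E) /\
  weakly_converges (fun N => @proj_measure R rho n N) nu.
Proof.
have [m mE] := @density_measure_exists _ _ _ (leb n) _ measurable_limit_density limit_density_ge0.
have [nu nuE] := @probability_exists R _ _ m ltac:(by rewrite mE integral_limit_densityT).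
have nuI A : nu A = (\int[leb n]_(x in A) limit_density rho sigma x)%E.
  by rewrite nuE mE.
exists nu; split; first by move=> A _; exact: nuI.
apply: proj_measure_weak_cvg => //; last by move=> A _; exact: nuI.
exact: etrans (nuI setT) integral_limit_densityT.
Qed.

End radial_law.

Theorem theorem1p1 (R : realType) (n : nat) (n_gt0 : (0 < n)%N)
  (rho sigma : R -> R)
  (rho_gt0 : forall t, 0 < t -> 0 < rho t)
  (rho_C1 : forall t, 0 < t ->
    derivable rho t 1 /\ {for t, continuous rho^`()%classic})
  (rho_incr : {homo radial_map1 rho : s t / s < t})
  (sigmaK : cancel (radial_map1 rho) sigma) :
  (forall x : 'rV[R]_n, x != 0 ->
     (\forall N \near \oo,
        (@radial_proj R rho n N @` @sphere R N) x ->
        cvg (proj_ball_ratio rho N x e @[e --> 0^'+])) /\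
     proj_density rho N x @[N --> \oo] --> limit_density rho sigma x)
  /\
  (* Without this condition on the critical points the push-forwards have a
     singular part and no density. *)
  (@lebesgue_measure R
     [set t | 0 < t /\ (radial_map1 rho)^`()%classic t = 0] = 0%E ->
   (forall N, (n < N)%N ->
      is_density (@proj_measure R rho n N) (@proj_density R rho n N)) /\
   measurable_fun setT (@limit_density R rho sigma n) /\
   (\int[@lebesgue_rV R n]_x limit_density rho sigma x = 1)%E /\
   exists nu : probability 'rV[R]_n R,
     (forall A, measurable A ->
        nu A = (\int[@lebesgue_rV R n]_(x in A) limit_density rho sigma x)%E)
     /\ weakly_converges (fun N => @proj_measure R rho n N) nu).
Proof.
split.
  by move=> x x0; exact: (proj_density_cvg _ _ rho_gt0 rho_C1 rho_incr sigmaK).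
move=> crit; split; [|split; [|split]].
- by move=> N nN; exact: (proj_is_density _ sigma).
- exact: measurable_limit_density.
- exact: integral_limit_densityT.
- exact: limit_law.
Qed.
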